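(* Let $\kappa$ be a cardinal number of uncountable cofinality, and let $(\mathbb{P},<)$ be the finite support iteration of length $\kappa$ of Hechler forcing (adding $\kappa$ Hechler reals). If $(G,\otimes)$ is an $\aleph_0$-bounded $T_0$ topological group in the ground model, then $$\mathbf{1}_{\mathbb{P}}\Vdash \text{“}\check{G}\text{ has the property }\mathsf{S}_1(\Omega_{nbd},\Gamma)\text{”}.$$
   Context: A topological group $(G,\otimes)$ is $\aleph_0$-bounded if for every (open) neighborhood $U$ of the identity there is a countable $X\subseteq G$ with $X\otimes U=G$, where $S\otimes T=\{x\otimes y:x\in S,\ y\in T\}$. $\mathsf{S}_1(\Omega_{nbd},\Gamma)$ for a topological group $(G,\otimes)$: for every sequence $(U_n:n\in\mathbb{N})$ of neighborhoods of the identity there is a sequence $(F_n:n\in\mathbb{N})$ of finite subsets of $G$ such that each $x\in G$ belongs to $F_n\otimes U_n$ for all but finitely many $n$. Hechler forcing consists of pairs $(s,f)$ with $f\in\omega^\omega$ and $s$ a finite initial segment of $f$, where $(t,g)\le(s,f)$ iff $t\supseteq s$ and $g(n)\ge f(n)$ for all $n$; at each stage of the iteration it is taken in the sense of the extension at that stage. $\mathbf{1}_{\mathbb{P}}$ is the greatest element of $\mathbb{P}$. In the generic extension, $\check{G}$ denotes the ground model group $G$ with the topology having the ground model topology of $G$ as a base. *)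

(* Defs.v *)
(* MathComp / MathComp-Analysis *)
From HB Require Import structures.
From mathcomp Require Import all_boot all_order.
From mathcomp Require Import boolp classical_sets functions cardinality.
From mathcomp Require Import topology.

Set Implicit Arguments.
Unset Strict Implicit.
Unset Printing Implicit Defensive.

Local Open Scope classical_set_scope.

HB.structure Definition PreTopologicalGroup := {G of Topological G & Group G}.

HB.mixin Record PreTopologicalGroup_isTopologicalGroup G
    & PreTopologicalGroup G := {
  mulg_continuous : continuous (fun xy : G * G => (xy.1 * xy.2)%g) ;
  invg_continuous : continuous (fun x : G => (x^-1)%g)
}.

#[short(type="topologicalGroupType")]
HB.structure Definition TopologicalGroup :=
  {G of PreTopologicalGroup G & PreTopologicalGroup_isTopologicalGroup G}.

Definition aleph0_bounded (G : topologicalGroupType) : Prop :=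
  forall U : set G, nbhs (1%g : G) U ->
    exists2 X : set G, countable X & [set (x * y)%g | x in X & y in U] = setT.

(* The ambient type theory is the ground model.  A cardinal is a type K with a
   well-order (an ordinal, up to isomorphism) that is equinumerous to none of
   its proper initial segments. *)
Definition is_cardinal d (K : orderType d) : Prop :=
  well_founded (fun a b : K => (a < b)%O) /\
  forall a : K, ~~ ([set: K] #= [set b : K | (b < a)%O])%card.

Definition cofinal d (K : orderType d) (X : set K) : Prop :=
  forall a : K, exists2 x, X x & (a <= x)%O.

Definition uncountable_cofinality d (K : orderType d) : Prop :=
  forall X : set K, cofinal X -> ~ countable X.

(* A forcing notion on a subset of C; le q p means that q is stronger than p. *)
Record forcing_notion (C : Type) := ForcingNotion {
  dom : set C ;
  le : C -> C -> Prop
}.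

(* The forcing relation, on typed formulas.  Everything the formulas below talk
   about is an element of a ground model set A or a subset of such a set lying
   in the extension.  A name for a subset of (the check name of) A is a set of
   pairs (a, c), where a stands for its own check name and c is a condition.
   A formula is represented by the set of conditions forcing it: the primitive
   clauses are those for negation, conjunction and universal quantification,
   the other connectives being the usual classical abbreviations. *)
Definition name (C A : Type) := set (A * C).
Definition fprop (C : Type) := C -> Prop.

Section Forcing.
Variables (C : Type) (P : forcing_notion C).
Implicit Types (p q r : C) (phi psi : fprop C).

Definition is_name A (t : name C A) : Prop :=
  forall a c, t (a, c) -> dom P c.

(* "check a belongs to t": below p, the conditions that are stronger than some
   c with (a, c) in t are dense. *)
Definition fmem A (a : A) (t : name C A) : fprop C := fun p =>
  forall q, dom P q -> le P q p ->
    exists r c, [/\ dom P r, le P r q, t (a, c) & le P r c].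

(* A ground model fact about check names that is absolute. *)
Definition fcheck (Q : Prop) : fprop C := fun=> Q.

Definition forces p phi : Prop := phi p.

Definition fnot phi : fprop C := fun p =>
  forall q, dom P q -> le P q p -> ~ phi q.
Definition fand phi psi : fprop C := fun p => phi p /\ psi p.

(* Quantification over the elements of the check name of A. *)
Definition fall A (phi : A -> fprop C) : fprop C := fun p =>
  forall a, phi a p.

(* Quantification over the subsets of the check name of A in the extension. *)
Definition fallS A (phi : name C A -> fprop C) : fprop C := fun p =>
  forall t, is_name t -> phi t p.

Definition fimp phi psi : fprop C := fnot (fand phi (fnot psi)).
Definition fiff phi psi : fprop C := fand (fimp phi psi) (fimp psi phi).
Definition fex A (phi : A -> fprop C) : fprop C :=
  fnot (fall (fun a => fnot (phi a))).
Definition fexS A (phi : name C A -> fprop C) : fprop C :=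
  fnot (fallS (fun t => fnot (phi t))).

(* A sequence of subsets of A is a subset of nat * A; this is its n-th term. *)
Definition term A (t : name C (nat * A)) (n : nat) : name C A :=
  [set x | t ((n, x.1), x.2)].

Definition ffunctional A B (f : name C (A * B)) : fprop C :=
  fall (fun a => fall (fun b => fall (fun b' =>
    fimp (fand (fmem (a, b) f) (fmem (a, b') f)) (fcheck (b = b'))))).

(* t is the range of a function whose domain is a natural number. *)
Definition ffinite A (t : name C A) : fprop C :=
  fex (fun k : nat => fexS (fun e : name C (nat * A) =>
    fand (ffunctional e)
   (fand (fall (fun i => fiff (fcheck (i < k)) (fex (fun a => fmem (i, a) e))))
         (fall (fun a => fiff (fmem a t) (fex (fun i => fmem (i, a) e))))))).

(* The name of a Hechler condition (s, f) is given as a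
   pair of names for subsets of nat * nat. *)
Definition freal (f : name C (nat * nat)) : fprop C :=
  fand (ffunctional f) (fall (fun n => fex (fun m => fmem (n, m) f))).

Definition finitial (s f : name C (nat * nat)) : fprop C :=
  fex (fun k : nat => fall (fun n => fall (fun m =>
    fiff (fmem (n, m) s) (fand (fcheck (n < k)) (fmem (n, m) f))))).

Definition fhechler (sf : name C (nat * nat) * name C (nat * nat)) : fprop C :=
  fand (freal sf.2) (finitial sf.1 sf.2).

Definition fhechler_le
    (tg sf : name C (nat * nat) * name C (nat * nat)) : fprop C :=
  fand (fall (fun n => fall (fun m =>
          fimp (fmem (n, m) sf.1) (fmem (n, m) tg.1))))
       (fall (fun n => fall (fun m => fall (fun m' =>
          fimp (fand (fmem (n, m) sf.2) (fmem (n, m') tg.2))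
               (fcheck (m <= m')))))).

(* The topology of the check name of G in the extension has the ground model
   open sets as a base. *)
Definition fopen (G : topologicalType) (W : name C G) : fprop C :=
  fall (fun x => fimp (fmem x W)
    (fex (fun V : set G => fand (fcheck (open V /\ V x))
      (fall (fun y => fimp (fcheck (V y)) (fmem y W)))))).

Definition fnbhs (G : topologicalType) (x : G) (U : name C G) : fprop C :=
  fexS (fun W : name C G =>
    fand (fopen W) (fand (fmem x W)
      (fall (fun y => fimp (fmem y W) (fmem y U))))).

Definition fprod (G : topologicalGroupType) (x : G) (S T : name C G) :
    fprop C :=
  fex (fun y => fex (fun z =>
    fand (fmem y S) (fand (fmem z T) (fcheck (x = (y * z)%g))))).

Definition fS1_Omega_nbd_Gamma (G : topologicalGroupType) : fprop C :=
  fallS (fun U : name C (nat * G) =>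
    fimp (fall (fun n => fnbhs (1%g : G) (term U n)))
      (fexS (fun F : name C (nat * G) =>
        fand (fall (fun n => ffinite (term F n)))
             (fall (fun x : G => fex (fun N : nat => fall (fun n =>
                fimp (fcheck (N <= n))
                     (fprod x (term F n) (term U n))))))))).

End Forcing.

(* A name occurring in a condition of the iteration is given as a family of
   pairs indexed by a type, as in Aczel's encoding of sets: this makes the
   collection of all conditions an inductive type, where sets of pairs would
   violate strict positivity. *)
Record fam_name (A C : Type) := FamName {
  index : Type ;
  pairs : index -> A * C
}.

Definition name_of A C (t : fam_name A C) : name C A := range (@pairs A C t).

Section Iteration.
Variables (d : Order.disp_t) (K : orderType d).

(* A condition is a partial function on K.  Its domain is its support: off it,
   the value is understood to be the greatest element of the iterand. *)
Inductive cond : Type :=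
  Cond of (K -> option (fam_name (nat * nat) cond * fam_name (nat * nat) cond)).

Definition coord (p : cond) := let: Cond f := p in f.

Definition restrict (p : cond) (a : K) : cond :=
  Cond (fun b => if (b < a)%O then coord p b else None).

Definition hname (h : fam_name (nat * nat) cond * fam_name (nat * nat) cond) :=
  (name_of h.1, name_of h.2).

(* The finite support iteration along an initial segment B of K, given the
   iterations Q b along the segments below b, for b in B.  The b-th coordinate
   of a condition p is a (Q b)-name that the restriction of p to b forces to be
   in Hechler forcing. *)
Definition iteration_step (B : set K)
    (Q : forall b, B b -> forcing_notion cond) : forcing_notion cond :=
  {| dom := [set p | finite_set [set b | coord p b <> None] /\
        forall b h, coord p b = Some h -> exists Bb : B b,
          [/\ is_name (Q b Bb) (hname h).1, is_name (Q b Bb) (hname h).2 &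
              fhechler (Q b Bb) (hname h) (restrict p b)]] ;
     le := fun q p => forall b h, coord p b = Some h ->
        exists (Bb : B b) h', coord q b = Some h' /\
          fhechler_le (Q b Bb) (hname h') (hname h) (restrict q b) |}.

Hypothesis wfK : well_founded (fun a b : K => (a < b)%O).

Definition iteration_below : K -> forcing_notion cond :=
  Fix wfK (fun=> forcing_notion cond)
    (fun a => @iteration_step [set b : K | (b < a)%O]).

Definition hechler_iteration : forcing_notion cond :=
  @iteration_step setT (fun b _ => iteration_below b).

Definition iteration_one : cond := Cond (fun=> None).

Lemma iteration_belowE (a : K) :
  iteration_below a =
  @iteration_step [set b : K | (b < a)%O] (fun b _ => iteration_below b).
Proof.
rewrite /iteration_below Fix_eq // => x f g fg; congr iteration_step.
by apply: functional_extensionality_dep => y;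
  apply: functional_extensionality_dep => h; exact: fg.
Qed.

Lemma iteration_one_greatest :
  dom hechler_iteration (iteration_one) /\
  forall p, dom hechler_iteration p -> le hechler_iteration p iteration_one.
Proof.
split=> //; split=> //=.
by rewrite (_ : [set b | _] = set0) // -subset0 => b /=.
Qed.

End Iteration.

(* Main.v *)
Require Import Defs.
From HB Require Import structures.
From mathcomp Require Import all_boot all_order.
From mathcomp Require Import boolp classical_sets functions cardinality.
From mathcomp Require Import topology.

Set Implicit Arguments.
Unset Strict Implicit.
Unset Printing Implicit Defensive.

Local Open Scope classical_set_scope.

Import Order.TTheory.

(** Write P for the iteration and Q a for the iteration below a.  Let U name a
    sequence of neighborhoods of the identity.  For each n the conditions
    deciding a ground model neighborhood V contained in U n are dense; take a
    maximal antichain A n of them.  The countable chain condition makes the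
    antichains countable, supports are finite, and K has uncountable
    cofinality, so some a in K bounds the supports of all members of all A n:
    the sequence of the decided neighborhoods already exists after forcing with
    Q a.  By boundedness of G every V decided by a member c of A n comes with a
    ground model sequence e of elements of G whose translates e i * V cover G.
    A point x of G thus gives a function in the extension by Q a: the value at
    n is an index i such that x lies in e i * V, where V is the neighborhood
    decided by the generic member of A n.  The Hechler real added at a
    dominates all these functions ([decides_dominates]), hence the finite sets
    of those e i with i at most its value at n are as required ([guess],
    [guess_finite], [guess_covers]).

    The argument takes place inside the forcing relation, and never passes to
    a generic extension.  Formulas are represented by regular sets of
    conditions ([regular]), for which implication and existence have their
    usual meaning in terms of extensions ([fimpE], [fex_dense]); every formula
    is unfolded in this way once.

    The remaining work is the countable chain condition of the iteration
    ([ccc_iter]), by induction along K.  It is enough to consider conditions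
    each of whose stems is decided ([stems_decided_dense]); two of them are
    compatible when their stems agree on the common part of the supports
    ([stems_compatible]).  Stems form finite partial functions from K to a
    countable set, and pairwise incompatible finite partial functions are
    countable in number ([countable_disagree]).  The induction is needed for
    an additional reason: a coordinate of a condition is a small name, and the
    pointwise maximum of two named reals has an equivalent small name only
    because the iteration below satisfies the chain condition
    ([nice_name]). *)

(** * The forcing relation over a preorder *)

Section ForcingLogic.
Context {C : Type}.
Variable P : forcing_notion C.
Implicit Types (p q r c : C) (phi psi : fprop C).

(** The order of a forcing notion may relate arbitrary elements of [C];
    recording membership of both sides makes the relation transitive without
    side conditions. *)
Definition ext q p := [/\ dom P q, dom P p & le P q p].

Definition preorder_on :=
  (forall p, dom P p -> le P p p) /\
  (forall p q r, ext p q -> ext q r -> le P p r).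

Definition compatible p q := exists r, ext r p /\ ext r q.

Definition antichain (A : set C) :=
  A `<=` dom P /\ forall p q, A p -> A q -> compatible p q -> p = q.

Definition ccc := forall A, antichain A -> countable A.

(** The two properties of a set of conditions that make it the truth value of
    a formula: persistence under extension, and the fact that what is forced
    densely below a condition is forced by it. *)
Definition regular phi :=
  (forall p q, ext q p -> phi p -> phi q) /\
  (forall p, dom P p ->
     (forall q, ext q p -> exists2 r, ext r q & phi r) -> phi p).

Hypothesis preP : preorder_on.

Lemma ext_refl p : dom P p -> ext p p.
Proof. by move=> dp; split=> //; apply: preP.1. Qed.

Lemma ext_trans p q r : ext p q -> ext q r -> ext p r.
Proof.
by move=> pq qr; split; [case: pq | case: qr | apply: preP.2 pq qr].
Qed.

Lemma ext_doml p q : ext p q -> dom P p. Proof. by case. Qed.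
Lemma ext_domr p q : ext p q -> dom P q. Proof. by case. Qed.

Lemma regular_fmem A (a : A) t : regular (fmem P a t).
Proof.
split=> [p q qp + r dr rq|p dp tp q dq qp].
  by apply=> //; case: (ext_trans (And3 dr (ext_doml qp) rq) qp).
have [r rq +] := tp q (And3 dq dp qp).
move=> /(_ r (ext_doml rq)); case; first exact: (preP.1 _ (ext_doml rq)).
move=> r' [c [dr' r'r tc r'c]]; exists r', c; split=> //.
by case: (ext_trans (And3 dr' (ext_doml rq) r'r) rq).
Qed.

Lemma regular_fcheck Q : regular (@fcheck C Q).
Proof.
split=> // p dp /(_ p (ext_refl dp)).
by case.
Qed.

Lemma regular_fnot phi : (forall p q, ext q p -> phi p -> phi q) ->
  regular (fnot P phi).
Proof.
move=> mono; split=> [p q qp np r dr rq|p dp np q dq qp pq].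
  by apply: np => //; case: (ext_trans (And3 dr (ext_doml qp) rq) qp).
have [r rq /(_ r (ext_doml rq) (preP.1 _ (ext_doml rq)))] :=
  np q (And3 dq dp qp).
by apply; apply: mono pq.
Qed.

Lemma regular_fand phi psi :
  regular phi -> regular psi -> regular (fand phi psi).
Proof.
move=> [m1 d1] [m2 d2]; split=> [p q qp [p1 p2]|p dp dns].
  by split; [apply: m1 p1 | apply: m2 p2].
by split; [apply: d1 | apply: d2] => // q /dns[r rq []]; exists r.
Qed.

Lemma regular_fall A (phi : A -> fprop C) :
  (forall a, regular (phi a)) -> regular (fall phi).
Proof.
move=> rphi; split=> [p q qp pp a|p dp dns a].
  exact: (rphi a).1 qp (pp a).
by apply: (rphi a).2 => // q /dns[r rq /(_ a)]; exists r.
Qed.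

Lemma regular_fimp phi psi :
  regular phi -> regular (fimp P phi psi).
Proof.
move=> [m1 _]; apply: regular_fnot => p q qp [p1 p2]; split.
  exact: m1 p1.
by move=> r dr rq; apply: p2 => //;
  case: (ext_trans (And3 dr (ext_doml qp) rq) qp).
Qed.

Lemma regular_fiff phi psi :
  regular phi -> regular psi -> regular (fiff P phi psi).
Proof. by move=> r1 r2; apply: regular_fand; apply: regular_fimp. Qed.

Lemma regular_fex A (phi : A -> fprop C) : regular (fex P phi).
Proof.
apply: regular_fnot => p q qp np a r dr rq; apply: np => //.
by case: (ext_trans (And3 dr (ext_doml qp) rq) qp).
Qed.

Lemma regular_fexS A (phi : name C A -> fprop C) : regular (fexS P phi).
Proof.
apply: regular_fnot => p q qp np t nt r dr rq; apply: np => //.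
by case: (ext_trans (And3 dr (ext_doml qp) rq) qp).
Qed.

Lemma fimpE phi psi p : regular phi -> regular psi -> dom P p ->
  fimp P phi psi p <-> forall q, ext q p -> phi q -> psi q.
Proof.
move=> r1 r2 dp; split=> [pp q qp q1|pp q dq qp [q1 nq]].
  apply: r2.2 => [|r rq]; first exact: ext_doml qp.
  apply: contrapT => nr; have rp := ext_trans rq qp.
  apply: (pp r (ext_doml rp)); first by case: rp.
  split; first exact: r1.1 q1.
  move=> r' dr' r'r r2'; apply: nr; exists r' => //.
  by split=> //; exact: ext_doml rq.
apply: (nq q dq (preP.1 _ dq)); apply: pp q1; split=> //.
Qed.

Hint Resolve regular_fmem regular_fcheck regular_fand : core.

Lemma fimp_mp phi psi p q : regular phi -> regular psi -> ext q p ->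
  fimp P phi psi p -> phi q -> psi q.
Proof. by move=> r1 r2 qp /(fimpE r1 r2 (ext_domr qp)); apply. Qed.

Lemma fiffE phi psi p : regular phi -> regular psi -> dom P p ->
  fiff P phi psi p <-> forall q, ext q p -> phi q <-> psi q.
Proof.
move=> r1 r2 dp; split.
  by move=> [/(fimpE r1 r2 dp) h1 /(fimpE r2 r1 dp) h2] q qp;
    split; [apply: h1 | apply: h2].
by move=> h; split; apply/fimpE => // q qp; case: (h q qp).
Qed.

Lemma fexI A (phi : A -> fprop C) a p :
  (forall p q, ext q p -> phi a p -> phi a q) -> dom P p ->
  phi a p -> fex P phi p.
Proof.
move=> mono dp pa q dq qp /(_ a q dq (preP.1 _ dq)); apply.
exact: mono pa.
Qed.

Lemma fexSI A (phi : name C A -> fprop C) t p : is_name P t ->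
  (forall p q, ext q p -> phi t p -> phi t q) -> dom P p ->
  phi t p -> fexS P phi p.
Proof.
move=> nt mono dp pa q dq qp /(_ t nt q dq (preP.1 _ dq)); apply.
exact: mono pa.
Qed.

Lemma fex_dense A (phi : A -> fprop C) p q : ext q p -> fex P phi p ->
  exists a r, ext r q /\ phi a r.
Proof.
move=> [dq dp qp] /(_ q dq qp) nq; apply: contrapT => nr.
by apply: nq => a r dr rq pr; apply: nr; exists a, r.
Qed.

Lemma fexS_dense A (phi : name C A -> fprop C) p q : ext q p -> fexS P phi p ->
  exists t r, [/\ is_name P t, ext r q & phi t r].
Proof.
move=> [dq dp qp] /(_ q dq qp) nq; apply: contrapT => nr.
apply: nq => t nt r dr rq pr; apply: nr; exists t, r; split=> //.
Qed.

Lemma ext_fmem A (a : A) t p q : ext q p -> fmem P a t p -> fmem P a t q.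
Proof. exact: (regular_fmem a t).1. Qed.

(** A persistent relation between elements and conditions denotes, when read
    as a name, its own regularization.  Names can thus be given by what is to
    be forced about them. *)
Lemma fmem_dense A (R : A -> C -> Prop) (a : A) p : dom P p ->
  (forall p q, ext q p -> R a p -> R a q) ->
  fmem P a [set x | dom P x.2 /\ R x.1 x.2] p <->
  forall q, ext q p -> exists2 r, ext r q & R a r.
Proof.
move=> dp mono; split=> [tp q [dq _ qp]|dns q dq qp].
  have [r [c [dr rq [dc ac] rc]]] := tp q dq qp.
  by exists r => //; apply: mono ac; split.
have [r rq ra] := dns q (And3 dq dp qp); have dr := ext_doml rq.
by exists r, r; split=> //; [case: rq | exact: (preP.1 _ dr)].
Qed.

(** * Names for reals and for Hechler conditions *)

Implicit Types (f g s t : name C (nat * nat)).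

Lemma regular_freal f : regular (freal P f).
Proof.
apply: regular_fand; last by apply: regular_fall => n; exact: regular_fex.
do 3![apply: regular_fall => ?].
by apply: regular_fimp; apply: regular_fand; apply: regular_fmem.
Qed.

Lemma regular_finitial s f : regular (finitial P s f).
Proof. exact: regular_fex. Qed.

Lemma regular_fhechler h : regular (fhechler P h).
Proof.
apply: regular_fand; [exact: regular_freal | exact: regular_finitial].
Qed.

Lemma regular_fhechler_le h h' : regular (fhechler_le P h h').
Proof.
apply: regular_fand.
  do 2![apply: regular_fall => ?].
  by apply: regular_fimp; exact: regular_fmem.
do 3![apply: regular_fall => ?].
by apply: regular_fimp; apply: regular_fand; apply: regular_fmem.
Qed.

Lemma ffunctional_inj A B (f : name C (A * B)) p a b b' : dom P p ->
  ffunctional P f p -> fmem P (a, b) f p -> fmem P (a, b') f p -> b = b'.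
Proof.
move=> dp fun_f fb fb'.
by apply: (fimp_mp _ _ (ext_refl dp) (fun_f a b b')); auto.
Qed.

Lemma ffunctionalI A B (f : name C (A * B)) p : dom P p ->
  (forall q a b b', ext q p ->
     fmem P (a, b) f q -> fmem P (a, b') f q -> b = b') ->
  ffunctional P f p.
Proof.
move=> dp fp a b b'; apply/fimpE; [by auto.. | exact: dp |].
by move=> q qp [h1 h2]; apply: fp qp h1 h2.
Qed.

Lemma freal_fun f p n m m' : dom P p ->
  freal P f p -> fmem P (n, m) f p -> fmem P (n, m') f p -> m = m'.
Proof. by move=> dp [+ _]; exact: ffunctional_inj. Qed.

Lemma freal_ex f p n : dom P p -> freal P f p ->
  exists m q, ext q p /\ fmem P (n, m) f q.
Proof. by move=> dp [_ /(_ n)]; apply: fex_dense; exact: ext_refl. Qed.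

Lemma frealI f p : dom P p ->
  (forall q n m m', ext q p ->
     fmem P (n, m) f q -> fmem P (n, m') f q -> m = m') ->
  (forall q n, ext q p -> exists m r, ext r q /\ fmem P (n, m) f r) ->
  freal P f p.
Proof.
move=> dp f1 f2; split; first exact: ffunctionalI.
move=> n; apply: (regular_fex _).2 => // q qp.
have [m [r [rq rf]]] := f2 q n qp.
exists r => //; apply: (fexI (a := m)) => //; last exact: ext_doml rq.
by move=> ? ?; exact: ext_fmem.
Qed.

Lemma freal_eqv f g p : dom P p ->
  (forall x q, dom P q -> fmem P x f q <-> fmem P x g q) ->
  freal P f p -> freal P g p.
Proof.
move=> dp fg rf; apply: frealI => // [q n m m' qp|q n qp].
  move=> /(fg _ _ (ext_doml qp)) h /(fg _ _ (ext_doml qp)).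
  apply: (freal_fun (ext_doml qp)) h.
  exact: (regular_freal f).1 qp rf.
have [|m [r [rq h]]] := @freal_ex f q n (ext_doml qp).
  exact: (regular_freal f).1 qp rf.
by exists m, r; split=> //; apply/(fg _ _ (ext_doml rq)).
Qed.

Lemma finitial_dense s f p : dom P p -> finitial P s f p ->
  exists k q, ext q p /\ forall r n m, ext r q ->
    (fmem P (n, m) s r <-> n < k /\ fmem P (n, m) f r).
Proof.
move=> dp /(fex_dense (ext_refl dp))[k [q [qp sq]]]; exists k, q; split=> //.
move=> r n m rq; apply: (proj1 (fiffE _ _ (ext_domr rq)) (sq n m)) => //.
by auto.
Qed.

Lemma finitialI s f p k : dom P p ->
  (forall q n m, ext q p ->
     (fmem P (n, m) s q <-> n < k /\ fmem P (n, m) f q)) ->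
  finitial P s f p.
Proof.
have reg n m : regular (fand (@fcheck C (n < k)) (fmem P (n, m) f)) by auto.
move=> dp sf; apply: (fexI (a := k)) => //.
- apply: (proj1 (regular_fall _)) => n; apply: regular_fall => m.
  exact: regular_fiff.
- by move=> n m; apply/fiffE => // q; exact: sf.
Qed.

Lemma fhechler_leE t g s f p : dom P p ->
  fhechler_le P (t, g) (s, f) p <->
  (forall q n m, ext q p -> fmem P (n, m) s q -> fmem P (n, m) t q) /\
  (forall q n m m', ext q p ->
     fmem P (n, m) f q -> fmem P (n, m') g q -> m <= m').
Proof.
have reg n m m' : regular (fand (fmem P (n, m) f) (fmem P (n, m') g)) by auto.
move=> dp; split=> [[h1 h2]|[h1 h2]]; split.
- by move=> q n m qp; apply: (fimp_mp _ _ qp (h1 n m)).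
- move=> q n m m' qp h h'.
  by apply: (fimp_mp (reg n m m') _ qp (h2 n m m')).
- by move=> n m; apply/fimpE => // q; apply: h1.
- by move=> n m m'; apply/fimpE => // q qp []; apply: h2.
Qed.

Lemma fhechler_le_refl h p : dom P p -> freal P h.2 p -> fhechler_le P h h p.
Proof.
case: h => s f dp rf; apply/fhechler_leE => //; split=> // q n m m' qp h h'.
rewrite (freal_fun (ext_doml qp) _ h h') //.
by apply: (regular_freal f).1 rf.
Qed.

(** Transitivity uses that the real in the middle is total: a pair of values of
    the outer reals is compared through a value of it, found densely. *)
Lemma fhechler_le_trans h1 h2 h3 p : dom P p -> freal P h2.2 p ->
  fhechler_le P h1 h2 p -> fhechler_le P h2 h3 p -> fhechler_le P h1 h3 p.
Proof.
case: h1 h2 h3 => [s1 f1] [s2 f2] [s3 f3] dp /= rf.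
move=> /(fhechler_leE _ _ _ _ dp)[h1 h2] /(fhechler_leE _ _ _ _ dp)[h3 h4].
apply/fhechler_leE => //; split=> [q n m qp /(h3 _ _ _ qp)|q n m m' qp l3 l1].
  exact: h1.
have [|m2 [r [rq l2]]] := @freal_ex f2 q n (ext_doml qp).
  exact: (regular_freal f2).1 rf.
have rp := ext_trans rq qp.
by apply: leq_trans (h4 _ _ _ _ rp (ext_fmem rq l3) l2)
  (h2 _ _ _ _ rp l2 (ext_fmem rq l1)).
Qed.

(** The first component of a Hechler condition is forced to be an initial
    segment of a real, hence a finite sequence of ground model numbers; here a
    condition decides which one. *)
Definition stem s (w : seq nat) p := forall q n m, ext q p ->
  (fmem P (n, m) s q <-> n < size w /\ nth 0 w n = m).

Lemma ext_stem s w p q : ext q p -> stem s w p -> stem s w q.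
Proof. by move=> qp sp r n m rq; apply: sp; exact: ext_trans qp. Qed.

Lemma real_decide f k p : dom P p -> freal P f p ->
  exists w q, [/\ ext q p, size w = k &
    forall n, n < k -> fmem P (n, nth 0 w n) f q].
Proof.
move=> dp rf; elim: k => [|k [w [q [qp sw fw]]]].
  by exists [::], p; split=> //; exact: ext_refl.
have [|m [r [rq fm]]] := @freal_ex f q k (ext_doml qp).
  exact: (regular_freal f).1 rf.
exists (rcons w m), r; split.
- exact: ext_trans qp.
- by rewrite size_rcons sw.
- move=> n; rewrite ltnS leq_eqVlt nth_rcons sw => /predU1P[->|nk].
    by rewrite ltnn eqxx.
  by rewrite nk; apply: ext_fmem rq (fw n nk).
Qed.

(** The length of the stem is decided first, then its finitely many values. *)
Lemma stem_dense s f p : dom P p -> fhechler P (s, f) p ->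
  exists w q, ext q p /\ stem s w q.
Proof.
move=> dp [/= rf /finitial_dense]; case=> // k [q [qp sq]].
have [|w [r [rq sw fw]]] := @real_decide f k q (ext_doml qp).
  exact: (regular_freal f).1 rf.
exists w, r; split=> [|r' n m r'r]; first exact: ext_trans qp.
have r'q := ext_trans r'r rq.
have rf' : freal P f r' by apply: (regular_freal f).1 rf; exact: ext_trans qp.
rewrite sq // sw; split=> -[nk h]; split=> //.
  exact: (freal_fun (ext_doml r'r) rf' (ext_fmem r'r (fw n nk)) h).
by rewrite -h; apply: ext_fmem r'r (fw n nk).
Qed.

Lemma stem_real s f w p : dom P p -> fhechler P (s, f) p -> stem s w p ->
  forall n, n < size w -> fmem P (n, nth 0 w n) f p.
Proof.
move=> dp [/= rf sf] sw n nw; apply: (regular_fmem _ _).2 => // q qp.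
have [k [r [rq sr]]] :=
  finitial_dense (ext_doml qp) ((regular_finitial s f).1 _ _ qp sf).
exists r => //; have rp := ext_trans rq qp.
have dr := ext_doml rq.
apply: (proj2 ((sr r n (nth 0 w n) (ext_refl dr)).1 _)).
by apply/sw.
Qed.

Lemma stem_hechler s f w p : dom P p -> freal P f p -> stem s w p ->
  (forall n, n < size w -> fmem P (n, nth 0 w n) f p) -> fhechler P (s, f) p.
Proof.
move=> dp rf sw fw; split=> //=; apply: (finitialI (k := size w)) => //.
move=> q n m qp; rewrite sw //; split=> -[nw h]; split=> //.
  by rewrite -h; apply: ext_fmem qp (fw n nw).
apply: (freal_fun (ext_doml qp) _ (ext_fmem qp (fw n nw)) h).
by apply: (regular_freal f).1 rf.
Qed.

(** A real above both [f] and [g], except that below [k] it keeps the values of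
    [f]; so it still extends a stem of length [k] of [f]. *)
Definition max_from k f g : name C (nat * nat) :=
  [set x | dom P x.2 /\ exists m1 m2,
    [/\ fmem P (x.1.1, m1) f x.2, fmem P (x.1.1, m2) g x.2 &
        x.1.2 = if x.1.1 < k then m1 else maxn m1 m2]].

Lemma max_fromE k f g n m p : dom P p ->
  fmem P (n, m) (max_from k f g) p <->
  forall q, ext q p -> exists r m1 m2, [/\ ext r q,
    fmem P (n, m1) f r, fmem P (n, m2) g r &
    m = if n < k then m1 else maxn m1 m2].
Proof.
pose R (x : nat * nat) c := exists m1 m2,
  [/\ fmem P (x.1, m1) f c, fmem P (x.1, m2) g c &
      x.2 = if x.1 < k then m1 else maxn m1 m2].
move=> dp; rewrite (@fmem_dense _ R (n, m)) //; last first.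
  move=> p' q qp' [m1 [m2 [h1 h2 e]]].
  by exists m1, m2; split=> //; apply: ext_fmem qp' _.
split=> h q /h.
  by case=> r rq [m1 [m2 [h1 h2 e]]]; exists r, m1, m2.
by case=> r [m1 [m2 [rq h1 h2 e]]]; exists r => //; exists m1, m2.
Qed.

Lemma max_fromI k f g n m1 m2 p : dom P p ->
  fmem P (n, m1) f p -> fmem P (n, m2) g p ->
  fmem P (n, if n < k then m1 else maxn m1 m2) (max_from k f g) p.
Proof.
move=> dp h1 h2; apply/max_fromE => // q qp; exists q, m1, m2; split=> //.
- exact: ext_refl (ext_doml qp).
- exact: ext_fmem h1.
- exact: ext_fmem h2.
Qed.

Section MaxReal.
Variables (k : nat) (f g : name C (nat * nat)) (p : C).
Hypotheses (dp : dom P p) (rf : freal P f p) (rg : freal P g p).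

Lemma max_from_fun q n m m1 m2 : ext q p -> fmem P (n, m) (max_from k f g) q ->
  fmem P (n, m1) f q -> fmem P (n, m2) g q ->
  m = if n < k then m1 else maxn m1 m2.
Proof.
move=> qp /max_fromE -/(_ (ext_doml qp) _ (ext_refl (ext_doml qp))).
move=> [r [m1' [m2' [rq h1 h2 ->]]]] h1' h2'; have rp := ext_trans rq qp.
have dr := ext_doml rq.
rewrite (freal_fun dr ((regular_freal f).1 _ _ rp rf) h1 (ext_fmem rq h1')).
by rewrite (freal_fun dr ((regular_freal g).1 _ _ rp rg) h2 (ext_fmem rq h2')).
Qed.

Lemma max_from_ex q n : ext q p -> exists r m1 m2,
  [/\ ext r q, fmem P (n, m1) f r & fmem P (n, m2) g r].
Proof.
move=> qp.
have [|m1 [r [rq h1]]] := @freal_ex f q n (ext_doml qp).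
  exact: (regular_freal f).1 rf.
have rp := ext_trans rq qp.
have [|m2 [r' [rr' h2]]] := @freal_ex g r n (ext_doml rq).
  exact: (regular_freal g).1 rg.
exists r', m1, m2; split=> //; first exact: ext_trans rq.
exact: ext_fmem h1.
Qed.

Lemma max_from_real : freal P (max_from k f g) p.
Proof.
apply: frealI => // [q n m m' qp h h'|q n qp].
  have [r [m1 [m2 [rq h1 h2]]]] := max_from_ex n qp.
  have rp := ext_trans rq qp.
  rewrite (max_from_fun rp (ext_fmem rq h) h1 h2).
  by rewrite (max_from_fun rp (ext_fmem rq h') h1 h2).
have [r [m1 [m2 [rq h1 h2]]]] := max_from_ex n qp.
exists (if n < k then m1 else maxn m1 m2), r; split=> //.
exact: max_fromI (ext_doml rq) h1 h2.
Qed.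

Lemma max_from_gel q n m m' : ext q p ->
  fmem P (n, m) f q -> fmem P (n, m') (max_from k f g) q -> m <= m'.
Proof.
move=> qp h h'; have [r [m1 [m2 [rq h1 h2]]]] := max_from_ex n qp.
have rp := ext_trans rq qp.
rewrite (max_from_fun rp (ext_fmem rq h') h1 h2).
rewrite (freal_fun (ext_doml rq) _ (ext_fmem rq h) h1).
  by case: ifP => // _; exact: leq_maxl.
exact: (regular_freal f).1 rf.
Qed.

Lemma max_from_ger q n m m' : ext q p -> k <= n ->
  fmem P (n, m) g q -> fmem P (n, m') (max_from k f g) q -> m <= m'.
Proof.
move=> qp kn h h'; have [r [m1 [m2 [rq h1 h2]]]] := max_from_ex n qp.
have rp := ext_trans rq qp.
rewrite (max_from_fun rp (ext_fmem rq h') h1 h2) ltnNge kn /=.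
rewrite (freal_fun (ext_doml rq) _ (ext_fmem rq h) h2) ?leq_maxr //.
exact: (regular_freal g).1 rg.
Qed.

End MaxReal.

Lemma max_from_low k f g p n m : dom P p -> freal P g p ->
  n < k -> fmem P (n, m) f p -> fmem P (n, m) (max_from k f g) p.
Proof.
move=> dp rg nk h; apply/max_fromE => // q qp.
have [|m2 [r [rq h2]]] := @freal_ex g q n (ext_doml qp).
  exact: (regular_freal g).1 rg.
exists r, m, m2; rewrite nk; split=> //.
by apply: ext_fmem h; exact: ext_trans qp.
Qed.

(** * Maximal antichains and nice names *)

(** By Zorn's lemma.  If [E] is dense then so is, up to compatibility, the
    antichain: it meets every generic filter. *)
Lemma max_antichain (E : set C) : E `<=` dom P ->
  exists A, [/\ antichain A, A `<=` E &
    forall p, E p -> exists2 c, A c & compatible p c].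
Proof.
move=> EP.
have [F FE Ftot|A [[AE Aa] Amax]] := @Zorn_bigcup C
  [set A | A `<=` E /\ forall p q, A p -> A q -> compatible p q -> p = q].
  split=> [p [X FX]|p q [X FX Xp] [Y FY Yq]]; first exact: (FE X FX).1.
  have [XY|YX] := Ftot X Y FX FY.
    by apply: (FE Y FY).2 => //; exact: XY.
  by apply: (FE X FX).2 => //; exact: YX.
exists A; split=> //; first by split=> // p /AE /EP.
move=> p Ep; apply: contrapT => np.
have Ap : ~ A p.
  by move=> Ap; apply: np; exists p => //; exists p; split; apply/ext_refl/EP.
apply: (Amax (A `|` [set p])).
  split=> [q|/(_ p) s]; first by left.
  by apply/Ap/s; right.
split=> [q [/AE//|->//]|q r [Aq|->] [Ar|->] //]; first exact: Aa.
- by move=> qp; case: np; exists q => //; case: qp => x []; exists x.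
- by move=> pr; case: np; exists r => //; case: pr => x []; exists x.
Qed.

(** Conditions of the iteration carry only small families as names, whereas the
    names that arise below are sets of pairs that may be as large as the
    forcing notion.  The countable chain condition provides equivalent small
    names: it is enough to keep, for each pair of numbers, a maximal antichain
    of conditions forcing it into the set. *)
Lemma nice_name f : ccc -> exists h : fam_name (nat * nat) C,
  is_name P (name_of h) /\
  forall x p, dom P p -> fmem P x (name_of h) p <-> fmem P x f p.
Proof.
move=> cP.
have /choice[A AP] (x : nat * nat) : exists A, [/\ antichain A,
    A `<=` [set c | dom P c /\ fmem P x f c] &
    forall p, dom P p /\ fmem P x f p -> exists2 c, A c & compatible p c].
  by apply: max_antichain => c [].
have /choice[e eP] (x : nat * nat) : exists e : C -> nat,
    {in A x &, injective e}.
  by apply/countable_injP/cP; case: (AP x).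
pose I := {k : (nat * nat) * nat | exists c, A k.1 c /\ e k.1 c = k.2}.
pose v (i : I) := ((proj1_sig i).1, sval (cid (proj2_sig i))).
have vA i : A (v i).1 (v i).2 by rewrite /v /=; case: cid => c [].
have Av x c : A x c -> exists i, v i = (x, c).
  move=> Ac; have ex : exists c', A (x, e x c).1 c' /\ e x c' = e x c.
    by exists c.
  exists (exist _ (x, e x c) ex); rewrite /v /=; case: cid => c' /= [Ac' ecc'].
  by congr pair; apply: eP ecc'; rewrite inE.
exists (FamName v); split=> [x c [i _ /= vi]|x p dp].
  have := vA i; rewrite vi /= => Ac.
  by have [_ /(_ _ Ac)[]] := AP x.
split=> [h|h q dq qp].
  apply: (regular_fmem _ _).2 => // q [dq _ qp].
  have [r [c [dr rq [i _ /= vi] rc]]] := h q dq qp.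
  have := vA i; rewrite vi /= => Ac.
  have [_ /(_ _ Ac)[dc fc] _] := AP x.
  by exists r => //; apply: ext_fmem fc.
have qp' : ext q p by [].
have [_ _ /(_ q)] := AP x; case; first by split=> //; exact: ext_fmem h.
move=> c Ac [r [rq rc]]; have [i vi] := Av x c Ac.
exists r, c; split; [exact: ext_doml rq | by case: rq | | by case: rc].
by exists i.
Qed.

End ForcingLogic.

(** * Names for finite sets, neighborhoods and products *)

Section Formulas.
Context {C : Type}.
Variable P : forcing_notion C.
Hypothesis preP : preorder_on P.
Implicit Types (p q r c : C).

Lemma fmem_check A (X : set A) a p : dom P p ->
  fmem P a [set x | dom P x.2 /\ X x.1] p <-> X a.
Proof.
move=> dp; rewrite (@fmem_dense _ P preP _ (fun x _ => X x)) //.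
split=> [/(_ p (ext_refl preP dp))[]//|Xa q qp].
by exists q => //; exact: (ext_refl preP (ext_doml qp)).
Qed.

Lemma regular_ffunctional A B (f : name C (A * B)) :
  regular P (ffunctional P f).
Proof.
do 3![apply: regular_fall => ?]; apply: regular_fimp => //.
by apply: regular_fand; exact: regular_fmem.
Qed.

(** The enumeration of a set that is forced to equal a ground model finite set
    is the check name of a ground model enumeration. *)
Lemma ffiniteI A (t : name C A) k (u : nat -> A) p : dom P p ->
  (forall q y, ext P q p -> fmem P y t q <-> exists2 i, i < k & y = u i) ->
  ffinite P t p.
Proof.
move=> dp tP.
pose e : name C (nat * A) :=
  [set x | dom P x.2 /\ (x.1.1 < k /\ x.1.2 = u x.1.1)].
have eE i y q : dom P q -> fmem P (i, y) e q <-> i < k /\ y = u i.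
  exact: (@fmem_check _ (fun x => x.1 < k /\ x.2 = u x.1)).
have reg1 l (e' : name C (nat * A)) i : regular P
    (fiff P (@fcheck C (i < l)) (fex P (fun y => fmem P (i, y) e'))).
  by apply: regular_fiff => //; [exact: regular_fcheck | exact: regular_fex].
have reg2 (e' : name C (nat * A)) y : regular P
    (fiff P (fmem P y t) (fex P (fun i => fmem P (i, y) e'))).
  by apply: regular_fiff => //; [exact: regular_fmem | exact: regular_fex].
apply: (fexI preP (a := k)) => //; first exact: (regular_fexS preP _).1.
apply: (fexSI preP (t := e)) => //; first by move=> ? ? [].
  apply: (proj1 (regular_fand (regular_ffunctional _) (regular_fand _ _))).
    by apply: regular_fall => i; exact: reg1.
  by apply: regular_fall => y; exact: reg2.
split.
  apply: ffunctionalI => // q i y y' qp.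
  by move=> /(eE _ _ _ (ext_doml qp))[_ ->] /(eE _ _ _ (ext_doml qp))[_ ->].
split=> [i|y]; apply/(fiffE preP) => //; try exact: regular_fcheck;
  try exact: regular_fex; try exact: regular_fmem.
- move=> q qp; have dq := ext_doml qp; split=> [ik|].
    apply: (fexI preP (a := u i)) => //; last exact/eE.
    by move=> ? ?; exact: ext_fmem.
  move=> /(fex_dense (ext_refl preP dq))[y [r [rq]]].
  by move=> /(eE _ _ _ (ext_doml rq))[].
- move=> q qp; have dq := ext_doml qp; rewrite tP //; split=> [[i ik yi]|].
    apply: (fexI preP (a := i)) => //; last exact/eE.
    by move=> ? ?; exact: ext_fmem.
  move=> /(fex_dense (ext_refl preP dq))[i [r [rq]]].
  by move=> /(eE _ _ _ (ext_doml rq))[ik yi]; exists i.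
Qed.

Definition forces_subset A (V : set A) (t : name C A) p :=
  forall y, V y -> fmem P y t p.

Lemma ext_forces_subset A (V : set A) (t : name C A) p q : ext P q p ->
  forces_subset V t p -> forces_subset V t q.
Proof. by move=> qp Vt y /Vt; exact: ext_fmem. Qed.

(** In the extension the ground model open sets are a base, so a neighborhood
    contains a ground model one, which can be decided. *)
Lemma fnbhs_dense (G : topologicalType) (x : G) (t : name C G) p q :
  fnbhs P x t p -> ext P q p -> exists (V : set G) r,
    [/\ ext P r q, open V, V x & forces_subset V t r].
Proof.
move=> xt qp; have [W [r [nW rq [oW [xW Wt]]]]] := fexS_dense qp xt.
have dr := ext_doml rq.
have := fimp_mp preP (regular_fmem preP _ _) (regular_fex preP _)
  (ext_refl preP dr) (oW x) xW.
move=> /(fex_dense (ext_refl preP dr))[V [r' [r'r [[oV Vx] VW]]]].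
exists V, r'; split=> //; first exact: ext_trans r'r rq.
have dr' := ext_doml r'r; move=> y Vy.
apply: (fimp_mp preP (regular_fmem preP _ _) (regular_fmem preP _ _)
  r'r (Wt y)).
exact: (fimp_mp preP (regular_fcheck preP _) (regular_fmem preP _ _)
  (ext_refl preP dr') (VW y) Vy).
Qed.

Lemma fprodI (G : topologicalGroupType) (y z : G) (S T : name C G) p :
  dom P p -> fmem P y S p -> fmem P z T p -> Defs.fprod P (y * z)%g S T p.
Proof.
move=> dp yS zT; apply: (fexI preP (a := y)) => //.
  exact: (regular_fex preP _).1.
apply: (fexI preP (a := z)) => //.
by apply: (proj1 (regular_fand (regular_fmem preP _ _)
  (regular_fand (regular_fmem preP _ _) (regular_fcheck preP _)))).
Qed.

End Formulas.

Lemma aleph0_bounded_cover (G : topologicalGroupType) (V : set G) :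
  aleph0_bounded G -> nbhs (1%g : G) V ->
  exists e : nat -> G, forall x, exists i z, V z /\ x = (e i * z)%g.
Proof.
move=> bG /bG[X /countable_injP[f injf] XV].
have /choice[e eP] i : exists y : G, forall x, X x -> f x = i -> y = x.
  case: (pselect (exists2 x, X x & f x = i)) => [[x Xx <-]|nx].
    by exists x => x' Xx' /injf; rewrite !inE; move=> ->.
  by exists 1%g => x Xx fx; case: nx; exists x.
exists e => x; have : [set (x * y)%g | x in X & y in V] x by rewrite XV.
by move=> [y Xy [z Vz <-]]; exists (f y), z; rewrite (eP _ y).
Qed.

(** In a linear order, a set that is not cofinal is strictly bounded. *)
Lemma uncountable_cofinality_bound d (K : orderType d) (X : set K) :
  uncountable_cofinality K -> countable X ->
  exists a, forall x, X x -> (x < a)%O.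
Proof.
move=> cofK cX; apply: contrapT => na; apply: (cofK X) => // a.
apply: contrapT => nx; apply: na; exists a => x Xx; rewrite ltNge.
by apply/negP => ax; apply: nx; exists x.
Qed.

(** * Incompatible finite partial functions *)

Lemma finite_set_max d (K : orderType d) (A : set K) : finite_set A ->
  A = set0 \/ exists2 m, A m & forall x, A x -> (x <= m)%O.
Proof.
move=> /finite_seqP[s ->]; elim: s => [|a s IH].
  by left; rewrite -subset0 => x.
right; case: IH => [s0|[m /= sm mP]].
  have sa x : x \in s -> False.
    by move=> xs; have : [set` s] x by []; rewrite s0.
  exists a => [|x]; rewrite /= inE ?eqxx // => /orP[/eqP->//|/sa//].
exists (Order.max a m) => [|x].
  by rewrite /= inE; case: leP => _; rewrite ?eqxx // sm orbT.
rewrite /= inE => /orP[/eqP->|/mP xm]; first by rewrite le_max lexx.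
by rewrite le_max xm orbT.
Qed.

(** Association lists stand for finite partial functions. *)
Definition agree (K V : eqType) (l l' : seq (K * V)) :=
  forall k v v', (k, v) \in l -> (k, v') \in l' -> v = v'.

(** By induction on the size of the functions: every function of the family
    other than a fixed one disagrees with that one on one of its finitely many
    arguments, and the family splits into countably many pieces on each of which
    the value at such an argument is constant; this argument can be dropped. *)
Lemma countable_disagree (K : eqType) (V : countType) (T : Type)
    (A : set T) (phi : T -> seq (K * V)) :
  (forall p, A p -> agree (phi p) (phi p)) ->
  (forall p q, A p -> A q -> agree (phi p) (phi q) -> p = q) -> countable A.
Proof.
move=> selfA incA.
suff bounded n : forall (A : set T) (phi : T -> seq (K * V)),
    (forall p, A p -> agree (phi p) (phi p)) ->
    (forall p q, A p -> A q -> agree (phi p) (phi q) -> p = q) ->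
    (forall p, A p -> size (phi p) <= n) -> countable A.
  rewrite (_ : A = \bigcup_(n in setT) [set p | A p /\ size (phi p) <= n]).
    apply: bigcup_countable => [|n _]; first exact: countableP.
    apply: (bounded n _ phi) => [p [/selfA]|p q [Ap _] [Aq _]|p []] //.
    exact: incA.
  by rewrite predeqE => p; split=> [Ap|[n _ []//]]; exists (size (phi p)).
elim: n {A phi selfA incA} => [|n IH] A phi selfA incA sizeA.
  case: (pselect (exists p, A p)) => [[p0 Ap0]|A0].
    apply: (sub_countable _ (countable1 p0)); apply: subset_card_le => p Ap /=.
    apply: incA => // k v v'.
    by move: (sizeA p Ap); rewrite leqn0 => /nilP->.
  by rewrite (_ : A = set0) // -subset0 => p Ap; apply: A0; exists p.
case: (pselect (exists p, A p)) => [[p0 Ap0]|A0]; last first.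
  by rewrite (_ : A = set0) // -subset0 => p Ap; apply: A0; exists p.
pose D := [set` unzip1 (phi p0)].
pose piece k v := [set p | A p /\ (k, v) \in phi p].
pose pieces := \bigcup_(k in D) \bigcup_v piece k v.
apply: (sub_countable _ (_ : countable ([set p0] `|` pieces))).
  apply: subset_card_le => p Ap.
  case: (pselect (agree (phi p0) (phi p))) => [h|].
    by left; apply/esym/incA.
  move=> nagree; right; apply: contrapT => np; apply: nagree => k v v' kv kv'.
  by case: np; exists k; [apply/mapP; exists (k, v) | exists v'].
rewrite -bigcup2E; apply: bigcup_countable => [|i _]; first exact: countableP.
case: i => [|[|i]] /=; [exact: countable1 | | exact: countable0].
apply: bigcup_countable => [|k _].
  exact/finite_set_countable/finite_seqP/(ex_intro _ _ erefl).
apply: bigcup_countable => [|v _]; first exact: countableP.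
apply: (IH _ (fun p => [seq x <- phi p | x.1 != k])) => [p [Ap kvp]|p q|p].
- move=> k' v1 v2; rewrite !mem_filter => /andP[_ h1] /andP[_ h2].
  exact: (selfA p Ap) h1 h2.
- move=> [Ap kvp] [Aq kvq] ag; apply: incA => // k' v1 v2 h1 h2.
  have [kk'|kk'] := eqVneq k' k.
    rewrite kk' in h1 h2.
    by rewrite (selfA p Ap _ _ _ h1 kvp) (selfA q Aq _ _ _ h2 kvq).
  by apply: (ag k'); rewrite mem_filter /= kk'.
- move=> [Ap kvp]; rewrite -ltnS (leq_trans _ (sizeA p Ap)) // size_filter.
  rewrite -(count_predC (fun x : K * V => x.1 != k)) -[X in X < _]addn0.
  rewrite ltn_add2l -has_count; apply/hasP; exists (k, v) => //=.
  by rewrite eqxx.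
Qed.

(** * The structure of the iteration *)

Section Iteration.
Context {d : Order.disp_t} {K : orderType d}.
Hypothesis wfK : well_founded (fun a b : K => (a < b)%O).
Implicit Types (a b : K) (p q r : cond K) (B : set K).

Notation hechler_name :=
  (fam_name (nat * nat) (cond K) * fam_name (nat * nat) (cond K))%type.
Notation Q := (iteration_below wfK).
Notation restrict := Defs.restrict.

(** The iterations below the points of [K] and the full iteration are treated
    together, as the instances [seg a] and [setT]. *)
Definition iteration B : forcing_notion (cond K) :=
  @iteration_step _ K B (fun b _ => Q b).

Definition seg a : set K := [set b | (b < a)%O].

Lemma belowE a : Q a = iteration (seg a). Proof. exact: iteration_belowE. Qed.

Definition down_closed B := forall a b, B b -> (a < b)%O -> B a.

Lemma seg_down_closed a : down_closed (seg a).
Proof. by move=> b c ca bc; exact: lt_trans bc ca. Qed.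

Definition supp p : set K := [set b | coord p b <> None].

Definition valid b (h : hechler_name) p :=
  [/\ is_name (Q b) (hname h).1, is_name (Q b) (hname h).2 &
      fhechler (Q b) (hname h) p].

Lemma dom_iter B p : dom (iteration B) p <->
  finite_set (supp p) /\
  forall b h, coord p b = Some h -> B b /\ valid b h (restrict p b).
Proof.
split=> -[fp vp]; split=> // b h /vp; first by case=> Bb [? ? ?]; split.
by case=> Bb [? ? ?]; exists Bb.
Qed.

Lemma le_iter B q p : le (iteration B) q p <->
  forall b h, coord p b = Some h -> B b /\ exists h', coord q b = Some h' /\
    fhechler_le (Q b) (hname h') (hname h) (restrict q b).
Proof.
by split=> qp b h /qp; [case=> Bb [h' ?]; split=> //; exists h' |
  case=> Bb [h' ?]; exists Bb, h'].
Qed.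

Lemma coord_restrict p a b :
  coord (restrict p a) b = if (b < a)%O then coord p b else None.
Proof. by []. Qed.

Lemma restrict_restrict p a b : (b <= a)%O ->
  restrict (restrict p a) b = restrict p b.
Proof.
move=> ba; congr Cond; apply/funext => c; rewrite coord_restrict.
by case: ifP => // cb; rewrite (lt_le_trans cb ba).
Qed.

Lemma restrict_eq p q a : (forall b, (b < a)%O -> coord p b = coord q b) ->
  restrict p a = restrict q a.
Proof. by move=> pq; congr Cond; apply/funext => b; case: ifP => // /pq. Qed.

Lemma restrict_id p a : supp p `<=` seg a -> restrict p a = p.
Proof.
case: p => f fa; congr Cond; apply/funext => b; case: ifPn => // nba.
case e: (f b) => [h|] //=; move: nba; rewrite (fa b) //= /supp /=.
by rewrite e.
Qed.

Lemma supp_iter B p : dom (iteration B) p -> supp p `<=` B.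
Proof.
move=> /dom_iter[_ vp] b; rewrite /supp /=.
by case e: (coord p b) => [h|] // _; case: (vp b h e).
Qed.

Lemma restrict_below a p : dom (Q a) p -> restrict p a = p.
Proof. by rewrite belowE => /supp_iter; exact: restrict_id. Qed.

(** The set [B] enters the definitions only as a bound on supports. *)
Lemma dom_sub B B' p : dom (iteration B) p -> supp p `<=` B' ->
  dom (iteration B') p.
Proof.
move=> /dom_iter[fp vp] pB'; apply/dom_iter; split=> // b h e; split.
  by apply: pB'; rewrite /supp /= e.
by case: (vp b h e).
Qed.

Lemma ext_sub B B' p q : ext (iteration B) p q -> supp p `<=` B' ->
  supp q `<=` B' -> ext (iteration B') p q.
Proof.
move=> [dp dq /le_iter pq] pB' qB'.
split; [exact: dom_sub dp pB' | exact: dom_sub dq qB' |].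
apply/le_iter => b h e; split; first by apply: qB'; rewrite /supp /= e.
by case: (pq b h e).
Qed.

Lemma finite_supp_restrict p a : finite_set (supp p) ->
  finite_set (supp (restrict p a)).
Proof. by apply: sub_finite_set => b; rewrite /supp /=; case: ifP. Qed.

Lemma dom_restrict B p a : dom (iteration B) p -> dom (Q a) (restrict p a).
Proof.
rewrite belowE => /dom_iter[fp vp]; apply/dom_iter; split.
  exact: finite_supp_restrict.
move=> b h; rewrite coord_restrict; case: ifP => // ba /vp[_ v]; split=> //.
by rewrite restrict_restrict // ltW.
Qed.

Lemma ext_restrict B p q a : ext (iteration B) q p ->
  ext (Q a) (restrict q a) (restrict p a).
Proof.
move=> [dq dp /le_iter qp].
split; [exact: dom_restrict dq | exact: dom_restrict dp |].
rewrite belowE; apply/le_iter => b h.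
rewrite !coord_restrict; case: ifP => // ba /qp[_ [h' [e h'h]]]; split=> //.
by exists h'; split=> //; rewrite restrict_restrict // ltW.
Qed.

Lemma ext_below B p q a : ext (iteration B) q p -> supp p `<=` seg a ->
  ext (Q a) (restrict q a) p.
Proof. by move=> qp /restrict_id <-; exact: ext_restrict qp. Qed.

Lemma preorder_step B : (forall b, B b -> preorder_on (Q b)) ->
  preorder_on (iteration B).
Proof.
move=> preQ; split=> [p dp|p q r pq [dq dr /le_iter qr]].
  apply/le_iter => b h e.
  have [Bb [_ _ [rh _]]] := (proj2 ((dom_iter B p).1 dp)) b h e.
  split=> //; exists h; split=> //.
  by apply: fhechler_le_refl => //; [exact: preQ | exact: dom_restrict dp].
have [dp _ /le_iter pq'] := pq; apply/le_iter => b h e.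
have [Bb [h' [e' h'h]]] := qr b h e.
have [_ [h'' [e'' h''h']]] := pq' b h' e'; split=> //; exists h''; split=> //.
have [_ [_ _ [rh' _]]] := (proj2 ((dom_iter B q).1 dq)) b h' e'.
have pqb := ext_restrict b pq; have preb := preQ b Bb.
apply: fhechler_le_trans h''h' _ => //; first exact: dom_restrict dp.
  exact: (regular_freal preb _).1 pqb rh'.
exact: (regular_fhechler_le preb _ _).1 pqb h'h.
Qed.

Lemma preorder_below a : preorder_on (Q a).
Proof.
elim/(well_founded_ind wfK): a => a IH; rewrite belowE.
exact: preorder_step.
Qed.

Lemma preorder_iter B : preorder_on (iteration B).
Proof. by apply: preorder_step => b _; exact: preorder_below. Qed.

Lemma valid_ext a h p q : ext (Q a) q p -> valid a h p -> valid a h q.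
Proof.
move=> qp [n1 n2 vh]; split=> //.
exact: (regular_fhechler (preorder_below a) _).1 qp vh.
Qed.

Lemma coord_valid B p b h : dom (iteration B) p -> coord p b = Some h ->
  valid b h (restrict p b).
Proof. by move=> /dom_iter[_ vp] /vp[]. Qed.

Lemma coord_le B p q b h : ext (iteration B) q p -> coord p b = Some h ->
  exists h', coord q b = Some h' /\
    fhechler_le (Q b) (hname h') (hname h) (restrict q b).
Proof. by move=> [_ _ /le_iter qp] /qp[]. Qed.

(** Validity and order at a coordinate are a matter of what the part of the
    condition below it forces, so that a common extension of given conditions
    can be verified coordinate by coordinate, by induction along [K]. *)
Lemma iter_build B (S : set (cond K)) r :
  S `<=` dom (iteration B) -> finite_set (supp r) ->
  (forall b, dom (Q b) (restrict r b) ->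
     (forall q, S q -> ext (Q b) (restrict r b) (restrict q b)) ->
     (forall h, coord r b = Some h -> B b /\ valid b h (restrict r b)) /\
     (forall q h, S q -> coord q b = Some h -> exists h',
        coord r b = Some h' /\
        fhechler_le (Q b) (hname h') (hname h) (restrict r b))) ->
  dom (iteration B) r /\ forall q, S q -> ext (iteration B) r q.
Proof.
move=> SB fr step.
have low b : dom (Q b) (restrict r b) /\
    forall q, S q -> ext (Q b) (restrict r b) (restrict q b).
  elim/(well_founded_ind wfK): b => b IH.
  have dr : dom (Q b) (restrict r b).
    rewrite belowE; apply/dom_iter; split; first exact: finite_supp_restrict.
    move=> c h; rewrite coord_restrict; case: ifP => // cb e; split=> //.
    have [d1 d2] := IH c cb; rewrite restrict_restrict ?ltW //.
    by case: (proj1 (step c d1 d2) h e).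
  split=> // q Sq; split=> //; first exact: dom_restrict (SB q Sq).
  rewrite belowE; apply/le_iter => c h; rewrite !coord_restrict.
  case: ifP => // cb e; split=> //; rewrite restrict_restrict ?ltW //.
  have [d1 d2] := IH c cb.
  exact: (proj2 (step c d1 d2)) Sq e.
have dr : dom (iteration B) r.
  apply/dom_iter; split=> // b h; have [d1 d2] := low b.
  exact: (proj1 (step b d1 d2)).
split=> // q Sq; split=> //; first exact: SB.
apply/le_iter => b h e; have [d1 d2] := low b; split.
  by apply: (supp_iter (SB q Sq)); rewrite /supp /= e.
exact: (proj2 (step b d1 d2)) Sq e.
Qed.

Definition splice p a r h : cond K :=
  Cond (fun b => if (b < a)%O then coord r b
                 else if b == a then Some h else coord p b).

Lemma splice_restrict p a r h : dom (Q a) r -> restrict (splice p a r h) a = r.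
Proof.
move=> dr; rewrite -[RHS](restrict_below dr).
by apply: restrict_eq => b /= ->.
Qed.

Lemma splice_at p a r h : coord (splice p a r h) a = Some h.
Proof. by rewrite /= ltxx eqxx. Qed.

(** The way in which conditions are strengthened: the value at [a] is replaced
    by one whose required properties are forced only by an extension [r] of the
    part below [a].  The values above [a] remain valid by persistence. *)
Lemma splice_ext B p a r h : down_closed B -> dom (iteration B) p -> B a ->
  ext (Q a) r (restrict p a) -> valid a h r ->
  (forall h0, coord p a = Some h0 ->
     fhechler_le (Q a) (hname h) (hname h0) r) ->
  ext (iteration B) (splice p a r h) p.
Proof.
move=> Bdc dp Ba rp vh hle; have dr := ext_doml rp.
have [/dom_iter[finp _] dr'] := (dp, dr).
rewrite belowE in dr'; have /dom_iter[finr vr] := dr'.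
apply: (proj2 (@iter_build B [set p] (splice p a r h) _ _ _)) => //.
- by move=> _ ->.
- apply: (@sub_finite_set _ _ (supp r `|` (supp p `|` [set a]))); last first.
    by rewrite !finite_setU; split=> //; split=> //; exact: finite_set1.
  move=> b; rewrite /supp /=; case: ifP => _; first by left.
  by case: eqP => [->|_]; right; [right | left].
move=> b db Sb; have pb := Sb p erefl.
case: (ltgtP b a) => [ba|ab|ba].
- have rb : restrict (splice p a r h) b = restrict r b.
    by apply: restrict_eq => c cb /=; rewrite (lt_trans cb ba).
  rewrite rb /= ba; split=> [h' e|_ h' -> e].
    by have [_ v] := vr b h' e; split=> //; exact: Bdc ba.
  have e' : coord (restrict p a) b = Some h' by rewrite coord_restrict ba.
  by rewrite belowE in rp; exact: coord_le rp e'.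
- rewrite /= ltNge (ltW ab) /= gt_eqF //; split=> [h' e|_ h' -> e].
    split; first by apply: (supp_iter dp); rewrite /supp /= e.
    exact: valid_ext pb (coord_valid dp e).
  exists h'; split=> //; apply: fhechler_le_refl => //.
    exact: preorder_below.
  by have [_ _ []] := valid_ext pb (coord_valid dp e).
- rewrite ba splice_at splice_restrict //; split=> [h' [<-]|_ h' -> e] //.
  by exists h; split=> //; exact: hle.
Qed.

End Iteration.

(** * The countable chain condition *)

Section ChainCondition.
Context {d : Order.disp_t} {K : orderType d}.
Hypothesis wfK : well_founded (fun a b : K => (a < b)%O).
Implicit Types (a b : K) (p q r : cond K) (B : set K).
Notation Q := (iteration_below wfK).
Notation restrict := Defs.restrict.
Notation iteration := (iteration wfK).
Notation preorder_below := (preorder_below wfK).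
Notation preorder_iter := (preorder_iter wfK).

(** Where both supports meet, the pointwise maximum of the two reals still
    extends the common stem and bounds both reals. *)
Lemma stems_compatible B p1 p2 : (forall b, B b -> ccc (Q b)) ->
  dom (iteration B) p1 -> dom (iteration B) p2 ->
  (forall b h1 h2, coord p1 b = Some h1 -> coord p2 b = Some h2 -> exists w,
     stem (Q b) (hname h1).1 w (restrict p1 b) /\
     stem (Q b) (hname h2).1 w (restrict p2 b)) ->
  compatible (iteration B) p1 p2.
Proof.
move=> cccQ dp1 dp2 stems.
have /choice[M MP] (x : K * (fam_name (nat * nat) (cond K) *
                             fam_name (nat * nat) (cond K))) :
    exists h : fam_name (nat * nat) (cond K), B x.1 ->
      is_name (Q x.1) (name_of h) /\ forall y q, dom (Q x.1) q ->
        fmem (Q x.1) y (name_of h) q <->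
        fmem (Q x.1) y
          (max_from (Q x.1) 0 (name_of x.2.1) (name_of x.2.2)) q.
  case: (pselect (B x.1)) => [Bx|nBx]; last by exists x.2.1.
  have [h hP] := nice_name (preorder_below x.1)
    (max_from (Q x.1) 0 (name_of x.2.1) (name_of x.2.2)) (cccQ _ Bx).
  by exists h.
pose r : cond K := Cond (fun b => match coord p1 b, coord p2 b with
  | Some h1, Some h2 => Some (h1.1, M (b, (h1.2, h2.2)))
  | Some h1, None => Some h1
  | None, o => o end).
have [|||_ rS] := @iter_build _ _ wfK B [set p | p = p1 \/ p = p2] r.
- by move=> p [->|->].
- apply: (@sub_finite_set _ _ (supp p1 `|` supp p2)); last first.
    by rewrite finite_setU; split; [case/dom_iter: dp1 | case/dom_iter: dp2].
  move=> b; rewrite /supp /=; case: (coord p1 b) => [h1|]; first by left.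
  by move=> h; right.
- move=> b db Sb; have preb := preorder_below b.
  have r1 := Sb p1 (or_introl erefl); have r2 := Sb p2 (or_intror erefl).
  have Brefl p h : dom (iteration B) p ->
      ext (Q b) (restrict r b) (restrict p b) ->
      coord p b = Some h -> [/\ B b, valid wfK b h (restrict r b) &
        fhechler_le (Q b) (hname h) (hname h) (restrict r b)].
    move=> dp rp e; have v := valid_ext rp (coord_valid dp e).
    split=> //; first by apply: (supp_iter dp); rewrite /supp /= e.
    by apply: fhechler_le_refl => //; have [_ _ []] := v.
  case e1: (coord p1 b) => [h1|]; case e2: (coord p2 b) => [h2|];
    rewrite /= e1 e2; last first.
  + by split=> // q h [->|->]; rewrite ?e1 ?e2.
  + have [Bb v vr] := Brefl _ _ dp2 r2 e2.
    split=> [h [<-] //|q h [->|->]]; rewrite ?e1 ?e2 // => -[<-].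
    by exists h2.
  + have [Bb v vr] := Brefl _ _ dp1 r1 e1.
    split=> [h [<-] //|q h [->|->]]; rewrite ?e1 ?e2 // => -[<-].
    by exists h1.
  have [Bb [n1 n1' v1] _] := Brefl _ _ dp1 r1 e1.
  have [_ [n2 n2' v2] _] := Brefl _ _ dp2 r2 e2.
  have [w [s1 s2]] := stems b h1 h2 e1 e2.
  have {}s1 := ext_stem preb r1 s1; have {}s2 := ext_stem preb r2 s2.
  have [nM fM] := MP (b, (h1.2, h2.2)) Bb.
  rewrite /= in nM fM; set m := M _ in nM fM *.
  have [rf1 rf2] := (proj1 v1, proj1 v2).
  have dr := ext_doml r1.
  have rm : freal (Q b) (name_of m) (restrict r b).
    apply: (freal_eqv preb dr _ (max_from_real preb 0 dr rf1 rf2)).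
    by move=> x q dq; apply: iff_sym; exact: fM.
  split=> [h [<-]|q h].
    split=> //; split=> //; apply: (stem_hechler preb dr rm s1) => n nw.
    (* Within the common stem both reals, hence their maximum, follow [w]. *)
    apply/fM => //; rewrite -[nth _ _ _]maxnn.
    exact: (max_fromI preb 0 dr (stem_real preb dr v1 s1 nw)
                               (stem_real preb dr v2 s2 nw)).
  move=> qS e; exists (h1.1, m); split=> //.
  case: qS e => ->; rewrite ?e1 ?e2 => -[<-].
    apply/(fhechler_leE preb _ _ _ _ dr); split=> // q' n k k' q'r h1k.
    move=> /(fM _ _ (ext_doml q'r)); exact: (max_from_gel preb rf1 rf2 q'r h1k).
  apply/(fhechler_leE preb _ _ _ _ dr); split=> [q' n k q'r|q' n k k' q'r h2k].
    by move=> /(s2 _ _ _ q'r) nk; apply/s1.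
  move=> /(fM _ _ (ext_doml q'r)); exact: (max_from_ger preb rf1 rf2 q'r _ h2k).
by exists r; split; apply: rS; [left | right].
Qed.

Definition stems_decided p := forall b h, coord p b = Some h ->
  exists w, stem (Q b) (hname h).1 w (restrict p b).

(** By recursion on the largest point of the support. *)
Lemma stems_decided_dense B p : down_closed B -> dom (iteration B) p ->
  exists q, ext (iteration B) q p /\ stems_decided q.
Proof.
suff step B' : down_closed B' -> (forall b, B' b -> forall p, dom (Q b) p ->
    exists q, ext (Q b) q p /\ stems_decided q) ->
    forall p, dom (iteration B') p ->
    exists q, ext (iteration B') q p /\ stems_decided q.
  move=> Bdc; apply: (step) => // a _ {p Bdc B}.
  elim/(well_founded_ind wfK): a => a IH; rewrite belowE.
  by apply: step => //; exact: seg_down_closed.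
move=> Bdc IH {}p dp; have [fp _] := (dom_iter wfK B' p).1 dp.
have [s0|[a pa amax]] := finite_set_max fp.
  exists p; split; first exact: (ext_refl (preorder_iter B') dp).
  move=> b h e; suff : supp p b by rewrite s0.
  by rewrite /supp /= e.
have Ba := supp_iter dp pa.
have prea := preorder_below a.
case e: (coord p a) => [h|]; last by rewrite /supp /= e in pa.
have v := coord_valid dp e.
have dpa := dom_restrict a dp.
have [_ _ vh] := v.
rewrite [hname h]surjective_pairing in vh.
have [w [q0 [q0p sw]]] := stem_dense prea dpa vh.
have [q1 [q1q0 dec]] := IH a Ba q0 (ext_doml q0p).
have q1p := ext_trans prea q1q0 q0p.
have v1 := valid_ext q1p v.
exists (splice p a q1 h); split.
  apply: splice_ext => // h0; rewrite e => -[<-].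
  by apply: fhechler_le_refl (ext_doml q1p) _ => //; have [_ _ []] := v1.
move=> b h' /=; case: (ltgtP b a) => [ba|ab|->].
- move=> /dec[w' sw']; exists w'.
  rewrite (@restrict_eq _ _ _ q1) // => c cb /=.
  by rewrite (lt_trans cb ba).
- move=> eb; have := amax b; rewrite leNgt ab; move=> /(_ _)/negP; case=> //.
  by rewrite /supp /= eb.
- move=> [<-]; exists w; rewrite splice_restrict; last exact: ext_doml q1p.
  exact: ext_stem sw.
Qed.

(** Extend each member of an antichain to a condition with decided stems; the
    finite partial functions formed by the stems disagree pairwise. *)
Lemma ccc_step B : down_closed B -> (forall b, B b -> ccc (Q b)) ->
  ccc (iteration B).
Proof.
move=> Bdc cccQ A [AB Ainc].
have /choice[phi phiP] p : exists x : cond K * seq (K * seq nat), A p ->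
    [/\ ext (iteration B) x.1 p, agree x.2 x.2 &
        forall b h, coord x.1 b = Some h -> exists w, (b, w) \in x.2 /\
          stem (Q b) (hname h).1 w (restrict x.1 b)].
  case: (pselect (A p)) => [Ap|nAp]; last by exists (p, [::]).
  have [q [qp dec]] := stems_decided_dense Bdc (AB p Ap).
  have /choice[w wP] b : exists w, forall h, coord q b = Some h ->
      stem (Q b) (hname h).1 w (restrict q b).
    case e: (coord q b) => [h|]; last by exists [::].
    by have [w sw] := dec b h e; exists w => _ [<-].
  have [/finite_seqP[s sE] _] := (dom_iter wfK B q).1 (ext_doml qp).
  exists (q, [seq (b, w b) | b <- s]); split=> //= [b w1 w2|b h e].
    by move=> /mapP[c _ [-> ->]] /mapP[c' _ [-> ->]].
  exists (w b); split; last exact: wP.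
  have : supp q b by rewrite /supp /= e.
  by rewrite sE /= => bs; apply/mapP; exists b.
apply: (@countable_disagree _ _ _ A (fun p => (phi p).2)).
  by move=> p Ap; case: (phiP p Ap).
move=> p q Ap Aq ag; apply: Ainc => //.
have [pp _ sp] := phiP p Ap; have [qq _ sq] := phiP q Aq.
have [|r [rp rq]] := stems_compatible cccQ (ext_doml pp) (ext_doml qq).
  move=> b h1 h2 /sp[w [wp s1]] /sq[w' [wq s2]].
  by exists w; split=> //; rewrite (ag _ _ _ wp wq).
by exists r; split; [exact: (ext_trans (preorder_iter B) rp pp) |
  exact: (ext_trans (preorder_iter B) rq qq)].
Qed.

Lemma ccc_below a : ccc (Q a).
Proof.
elim/(well_founded_ind wfK): a => a IH; rewrite belowE.
by apply: ccc_step => //; exact: seg_down_closed.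
Qed.

Lemma ccc_iter B : down_closed B -> ccc (iteration B).
Proof. by move=> Bdc; apply: ccc_step => // b _; exact: ccc_below. Qed.

End ChainCondition.

(** * The generic real at one coordinate *)

Section GenericReal.
Context {d : Order.disp_t} {K : orderType d}.
Hypothesis wfK : well_founded (fun a b : K => (a < b)%O).
Implicit Types (b : K) (p q r : cond K).
Notation Q := (iteration_below wfK).
Notation restrict := Defs.restrict.
Variables (B : set K) (a : K).
Hypotheses (Bdc : down_closed B) (Ba : B a).
Notation P := (iteration wfK B).

Let preP : preorder_on P. Proof. exact: preorder_iter. Qed.
Let preQ : preorder_on (Q a). Proof. exact: preorder_below. Qed.
Let cccQ : ccc (Q a). Proof. exact: ccc_below. Qed.

(** The Hechler real added at [a] extends all stems, so this is a way for [q] to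
    decide its value at [n]. *)
Definition decides q n m := exists2 h, coord q a = Some h &
  fmem (Q a) (n, m) (hname h).1 (restrict q a).

Lemma ext_decides q q' n m : ext P q' q -> decides q n m -> decides q' n m.
Proof.
move=> q'q [h e nm]; have [h' [e' h'h]] := coord_le q'q e.
exists h' => //; have q'qa := ext_restrict a q'q.
have dq' := ext_doml q'qa.
have [sub _] := (fhechler_leE preQ _ _ _ _ dq').1 h'h.
by apply: sub; [exact: ext_refl | exact: ext_fmem nm].
Qed.

Lemma stem_sub_real s f p n m : dom (Q a) p -> fhechler (Q a) (s, f) p ->
  fmem (Q a) (n, m) s p -> fmem (Q a) (n, m) f p.
Proof.
move=> dp [_ sf] nm; apply: (regular_fmem preQ _ _).2 => // q qp.
have dq := ext_doml qp.
have [k [r [rq sr]]] :=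
  finitial_dense preQ dq ((regular_finitial preQ s f).1 _ _ qp sf).
have dr := ext_doml rq; exists r => //.
apply: (proj2 ((sr r n m (ext_refl preQ dr)).1 _)).
by apply: ext_fmem nm => //; exact: ext_trans rq qp.
Qed.

Lemma decides_fun q n m m' : dom P q ->
  decides q n m -> decides q n m' -> m = m'.
Proof.
move=> dq [h e nm] [h' + nm']; rewrite e => -[hh']; rewrite -hh' in nm'.
have dqa := dom_restrict a dq.
have [_ _ vh] := coord_valid dq e; have [rh _] := vh.
rewrite [hname h]surjective_pairing in vh.
exact: (freal_fun preQ dqa rh (stem_sub_real dqa vh nm)
                              (stem_sub_real dqa vh nm')).
Qed.

(** Off its support a condition carries the trivial Hechler condition, which
    can be made explicit. *)
Lemma coord_default q : dom P q -> exists h,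
  valid wfK a h (restrict q a) /\ forall h0, coord q a = Some h0 -> h0 = h.
Proof.
move=> dq; have dqa := dom_restrict a dq.
case e: (coord q a) => [h|].
  by exists h; split=> [|h0 []//]; exact: coord_valid dq e.
have [z [nz zE]] := nice_name preQ
  [set x : nat * nat * cond K | dom (Q a) x.2 /\ x.1.2 = 0] cccQ.
have zP n m r : dom (Q a) r -> fmem (Q a) (n, m) (name_of z) r <-> m = 0.
  move=> dr; rewrite zE //.
  rewrite (@fmem_dense _ (Q a) preQ _ (fun (x : nat * nat) _ => x.2 = 0)) //.
  split=> [/(_ r (ext_refl preQ dr))[]//|m0 r' r'r].
  by exists r' => //; exact: (ext_refl preQ (ext_doml r'r)).
have [s [ns sE]] := nice_name preQ (set0 : name (cond K) (nat * nat)) cccQ.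
exists (s, z); split=> //; split=> //; split=> /=.
  apply: (frealI preQ dqa) => [r n m m' rq|r n rq].
    by move=> /(zP _ _ _ (ext_doml rq))-> /(zP _ _ _ (ext_doml rq)).
  exists 0, r; split; first exact: (ext_refl preQ (ext_doml rq)).
  exact/(zP _ _ _ (ext_doml rq)).
apply: (finitialI preQ (k := 0) dqa) => r n m rq; have dr := ext_doml rq.
split=> [/(sE _ _ dr)|[]//] /(_ r dr); case; first by case: (ext_refl preQ dr).
by move=> ? [? []].
Qed.

(** The stem of the condition at [a] can be prolonged along its real past
    [n]. *)
Lemma decides_dense q n : dom P q -> exists q' m, ext P q' q /\ decides q' n m.
Proof.
move=> dq; have dqa := dom_restrict a dq.
have [h [vh hq]] := coord_default dq; case: h vh hq => s f vh hq.
have [ns nf [rf sf]] := vh.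
have [k [r [rq sr]]] := finitial_dense preQ dqa sf.
have rfr := (regular_freal preQ _).1 _ _ rq rf.
have [m [r' [r'r fnm]]] := freal_ex preQ n (ext_doml rq) rfr.
have dr' := ext_doml r'r; have r'q := ext_trans preQ r'r rq.
(* The stem is only ever lengthened, hence the maximum. *)
pose k' := maxn k n.+1.
have [s' [ns' s'E]] := nice_name preQ
  [set x | dom (Q a) x.2 /\
           (x.1.1 < k' /\ fmem (Q a) x.1 (name_of f) x.2)] cccQ.
have s'P i j p : dom (Q a) p -> fmem (Q a) (i, j) (name_of s') p <->
    i < k' /\ fmem (Q a) (i, j) (name_of f) p.
  move=> dp; rewrite s'E // (@fmem_dense _ (Q a) preQ _
    (fun x c => x.1 < k' /\ fmem (Q a) x (name_of f) c)) //; last first.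
    by move=> p1 p2 p21 [? h]; split=> //; exact: ext_fmem h.
  split=> [dns|[ik' h] p' p'p]; last first.
    by exists p'; [exact: (ext_refl preQ (ext_doml p'p)) |
      split=> //; exact: ext_fmem h].
  split; first by have [p' _ []] := dns p (ext_refl preQ dp).
  by apply: (regular_fmem preQ _ _).2 => // p' /dns[p'' ? []]; exists p''.
have rfr' := (regular_freal preQ _).1 _ _ r'q rf.
exists (splice q a r' (s', f)), m; split.
  apply: splice_ext => // [|h0 /hq ->].
    split=> //; split=> //=; apply: (finitialI preQ (k := k') dr').
    by move=> p i j pr; apply/s'P/(ext_doml pr).
  apply/(fhechler_leE preQ _ _ _ _ dr'); split=> [p i j pr'|p i j j' pr' h h'].
    move=> /(sr _ _ _ (ext_trans preQ pr' r'r))[ik h].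
    by apply/(s'P _ _ _ (ext_doml pr')); split=> //; rewrite leq_max ik.
  rewrite (freal_fun preQ (ext_doml pr') _ h h') //.
  exact: (regular_freal preQ _).1 _ _ pr' rfr'.
exists (s', f); first exact: splice_at.
rewrite splice_restrict //; apply/(s'P _ _ _ dr').
by rewrite leq_max ltnSn orbT.
Qed.

(** In a Hechler condition [(s, f)] the real [f] may be raised above [g] beyond
    the stem, provided that [g] has a name in the iteration below [a]. *)
Lemma decides_dominates g q :
  (forall p, dom (Q a) p -> freal (Q a) g p) -> dom P q ->
  exists q' N, ext P q' q /\ forall p n m i, ext P p q' -> N <= n ->
    decides p n m -> fmem (Q a) (n, i) g (restrict p a) -> i <= m.
Proof.
move=> rg dq; have dqa := dom_restrict a dq.
have [h [vh hq]] := coord_default dq; case: h vh hq => s f vh hq.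
have [ns nf [rf sf]] := vh; rewrite /= in rf sf.
have [k [r [rq sr]]] := finitial_dense preQ dqa sf.
have dr := ext_doml rq.
have rfr := (regular_freal preQ _).1 _ _ rq rf.
have rgr := rg r dr.
have [f' [nf' f'E]] := nice_name preQ (max_from (Q a) k (name_of f) g) cccQ.
have rf' : freal (Q a) (name_of f') r.
  apply: (freal_eqv preQ dr _ (max_from_real preQ k dr rfr rgr)).
  by move=> x p dp; apply: iff_sym; exact: f'E.
have vf' : valid wfK a (s, f') r.
  split=> //; split=> //=; apply: (finitialI preQ (k := k) dr) => p n m pr.
  have dp := ext_doml pr; rewrite f'E // sr //.
  split=> -[nk h]; split=> //.
    exact: (max_from_low preQ dp (rg p dp) nk h).
  apply: (regular_fmem preQ _ _).2 => // p1 p1p.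
  have /(max_fromE preQ) := h; move=> /(_ dp _ p1p)[p2 [m1 [m2 [p21 h1 _]]]].
  by rewrite nk => ->; exists p2.
exists (splice q a r (s, f')), k; split.
  apply: splice_ext => // h0 /hq ->.
  apply/(fhechler_leE preQ _ _ _ _ dr); split=> // p n m m' pr h.
  move=> /(f'E _ _ (ext_doml pr)).
  exact: (max_from_gel preQ rfr rgr pr h).
move=> p n m i pq kn [[s2 f2] e nm] ni.
have dp := ext_doml pq; have dpa := dom_restrict a dp.
have [h2 [+ le2]] := coord_le pq (splice_at _ _ _ _).
rewrite e => -[h2E]; rewrite -{}h2E in le2.
have [_ f'2] := (fhechler_leE preQ _ _ _ _ dpa).1 le2.
have [_ _ v2] := coord_valid dp e.
have nm2 := stem_sub_real dpa v2 nm.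
have pr : ext (Q a) (restrict p a) r.
  by have := ext_restrict a pq; rewrite splice_restrict.
have rfp := (regular_freal preQ _).1 _ _ pr rf'.
have [m' [p' [p'p h']]] := freal_ex preQ n dpa rfp.
apply: leq_trans (f'2 _ _ _ _ p'p h' (ext_fmem preQ p'p nm2)).
have /f'E := h'; move=> /(_ (ext_doml p'p)).
exact: (max_from_ger preQ rfr rgr (ext_trans preQ p'p pr) kn
  (ext_fmem preQ p'p ni)).
Qed.

End GenericReal.

(** * The finite sets guessed by a Hechler real *)

Section Construction.
Context {d : Order.disp_t} {K : orderType d}.
Hypothesis wfK : well_founded (fun a b : K => (a < b)%O).
Notation Q := (iteration_below wfK).
Notation P := (iteration wfK setT).
Variable G : topologicalGroupType.
Hypothesis bG : aleph0_bounded G.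
Variable U : name (cond K) (nat * G).
Implicit Types (p q r c : cond K).

Let preP : preorder_on P. Proof. exact: preorder_iter. Qed.
Let setT_down_closed : down_closed [set: K]. Proof. by []. Qed.

(** A condition below which no neighborhood contained in [U n] is ever found
    qualifies too.  This makes such conditions dense, and not only dense below
    a condition forcing [U] to be a sequence of neighborhoods. *)
Definition decides_nbhd n (V : set G) c := [/\ open V, V 1%g &
  forall q V', ext P q c -> open V' -> V' 1%g ->
    forces_subset P V' (term U n) q -> forces_subset P V (term U n) c].

Lemma decides_nbhd_dense n p : dom P p ->
  exists V c, ext P c p /\ decides_nbhd n V c.
Proof.
move=> dp; case: (pselect (exists q V', [/\ ext P q p, open V', V' 1%g &
    forces_subset P V' (term U n) q])) => [[q [V [qp oV V1 Vq]]]|nq].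
  by exists V, q; split=> //; split.
exists setT, p; split; first exact: ext_refl.
by split=> // [|q V' qp oV' V'1 V'q]; [exact: openT | case: nq; exists q, V'].
Qed.

Lemma nbhd_antichains : exists (A : nat -> set (cond K))
    (V : nat -> cond K -> set G) (e : nat -> cond K -> nat -> G),
  [/\ forall n, antichain P (A n),
      forall n p, dom P p -> exists2 c, A n c & compatible P p c,
      forall n c, A n c -> decides_nbhd n (V n c) c &
      forall n c, A n c ->
        forall x, exists i z, V n c z /\ x = (e n c i * z)%g].
Proof.
have /choice[A AP] n : exists A, [/\ antichain P A,
    A `<=` [set c | dom P c /\ exists V, decides_nbhd n V c] &
    forall p, dom P p /\ (exists V, decides_nbhd n V p) ->
      exists2 c, A c & compatible P p c].
  by apply: (max_antichain preP) => c [].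
have /choice[Ve VeP] (x : nat * cond K) : exists Ve : set G * (nat -> G),
    A x.1 x.2 -> decides_nbhd x.1 Ve.1 x.2 /\
      forall y, exists i z, Ve.1 z /\ y = (Ve.2 i * z)%g.
  case: (pselect (A x.1 x.2)) => [Ax|nAx]; last by exists (setT, fun=> 1%g).
  have [_ AE _] := AP x.1; have [_ [V Vx]] := AE _ Ax.
  have [|e eP] := aleph0_bounded_cover (V := V) bG.
    by have [oV V1 _] := Vx; apply: open_nbhs_nbhs.
  by exists (V, e).
exists A, (fun n c => (Ve (n, c)).1), (fun n c => (Ve (n, c)).2); split.
- by move=> n; have [] := AP n.
- move=> n p dp; have [V [q [qp Vq]]] := decides_nbhd_dense n dp.
  have [_ _ /(_ q)] := AP n; case.
    by split; [exact: ext_doml qp | exists V].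
  move=> c Ac [r [rq rc]]; exists c => //.
  by exists r; split=> //; exact: ext_trans rq qp.
- by move=> n c /(VeP (n, c))[].
- by move=> n c /(VeP (n, c))[].
Qed.

Variables (A : nat -> set (cond K)) (V : nat -> cond K -> set G)
  (e : nat -> cond K -> nat -> G) (a : K).
Hypotheses (antiA : forall n, antichain P (A n))
  (maxA : forall n p, dom P p -> exists2 c, A n c & compatible P p c)
  (AV : forall n c, A n c -> decides_nbhd n (V n c) c)
  (AVe : forall n c, A n c ->
    forall x, exists i z, V n c z /\ x = (e n c i * z)%g)
  (Aa : forall n c, A n c -> supp c `<=` seg a).

(** Only conditions that settle both the member of [A n] in the generic filter
    and the value at [n] of the Hechler real contribute to the [n]-th set; this
    is what makes it finite. *)
Definition guess : name (cond K) (nat * G) :=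
  [set x | dom P x.2 /\ exists c m i, [/\ A x.1.1 c, ext P x.2 c,
     decides wfK a x.2 x.1.1 m, i <= m & x.1.2 = e x.1.1 c i]].

Lemma guess_name : is_name P guess. Proof. by move=> x c []. Qed.

Lemma guessE n y p : dom P p ->
  fmem P y (term guess n) p <->
  forall q, ext P q p -> exists2 r, ext P r q & exists c m i,
    [/\ A n c, ext P r c, decides wfK a r n m, i <= m & y = e n c i].
Proof.
move=> dp; apply: (@fmem_dense _ _ preP _ (fun y r => exists c m i,
    [/\ A n c, ext P r c, decides wfK a r n m, i <= m & y = e n c i])) => //.
move=> q r rq [c [m [i [Ac qc qm im ->]]]]; exists c, m, i; split=> //.
  exact: ext_trans rq qc.
exact: (ext_decides rq qm).
Qed.

Lemma settled_dense n q : dom P q -> exists r c m,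
  [/\ ext P r q, A n c, ext P r c & decides wfK a r n m].
Proof.
move=> dq; have [c Ac [r [rq rc]]] := maxA n dq.
have [r' [m [r'r r'm]]] :=
  decides_dense (a := a) setT_down_closed I n (ext_doml rq).
exists r', c, m; split=> //; first exact: ext_trans r'r rq.
exact: ext_trans r'r rc.
Qed.

(** Below a condition that has chosen its member of [A n] and decided the
    Hechler real at [n], the guess is a ground model finite set. *)
Lemma guess_settled n r c m q y : A n c -> ext P r c ->
  decides wfK a r n m -> ext P q r ->
  fmem P y (term guess n) q <-> exists2 i, i < m.+1 & y = e n c i.
Proof.
move=> Ac rc rm qr; have dq := ext_doml qr.
rewrite guessE //; split; last first.
  move=> [i im ->] q' q'q; exists q'; first exact: ext_refl (ext_doml q'q).
  have q'r := ext_trans preP q'q qr.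
  exists c, m, i; split=> //; first exact: ext_trans q'r rc.
  exact: (ext_decides q'r rm).
move=> /(_ q (ext_refl preP dq))[q' q'q [c' [m' [i [Ac' q'c' q'm' im' ->]]]]].
have q'r := ext_trans preP q'q qr.
have -> : c' = c.
  apply: (proj2 (antiA n)) => //; exists q'; split=> //.
  exact: ext_trans q'r rc.
exists i => //; rewrite ltnS (leq_trans im') //.
by rewrite (decides_fun (ext_doml q'q) q'm' (ext_decides q'r rm)).
Qed.

Lemma guess_finite n p : dom P p -> ffinite P (term guess n) p.
Proof.
move=> dp; apply: (regular_fex preP _).2 => // q qp.
have [r [c [m [rq Ac rc rm]]]] := settled_dense n (ext_doml qp).
exists r => //; apply: (ffiniteI preP (k := m.+1) (u := e n c)).
  exact: ext_doml rq.
by move=> q' y; exact: guess_settled.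
Qed.

(** The Hechler real at [a] dominates the function of the indices that put [x]
    into the translates: all members of the antichains have their supports
    below [a], so the iteration below [a] has a name for that function. *)
Lemma guess_covers x p : (forall n, fnbhs P (1%g : G) (term U n) p) ->
  forall q, ext P q p -> exists N r, ext P r q /\ forall n r', N <= n ->
    ext P r' r -> Defs.fprod P x (term guess n) (term U n) r'.
Proof.
move=> Up q qp.
have /choice[idx idxP] (y : nat * cond K) : exists i, A y.1 y.2 ->
    exists z, V y.1 y.2 z /\ x = (e y.1 y.2 i * z)%g.
  case: (pselect (A y.1 y.2)) => [Ay|]; last by exists 0.
  by have [i iP] := AVe Ay x; exists i.
(* A name, for the iteration below [a], of the function that maps [n] to the
   index of a translate of the [n]-th decided neighborhood containing [x]. *)
pose hit : name (cond K) (nat * nat) := [set y | dom (Q a) y.2 /\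
  exists c, [/\ A y.1.1 c, ext (Q a) y.2 c & y.1.2 = idx (y.1.1, c)]].
have preQ := preorder_below wfK a.
have hitE n i r : dom (Q a) r -> fmem (Q a) (n, i) hit r <->
    forall q, ext (Q a) q r -> exists2 q', ext (Q a) q' q &
      exists c, [/\ A n c, ext (Q a) q' c & i = idx (n, c)].
  move=> dr; apply: (@fmem_dense _ _ preQ _ (fun (y : nat * nat) q' =>
    exists c, [/\ A y.1 c, ext (Q a) q' c & y.2 = idx (y.1, c)])) => //.
  move=> r1 r2 r21 [c [Ac r1c ->]]; exists c; split=> //.
  exact: ext_trans r21 r1c.
have QaP r r' : ext (Q a) r r' -> ext P r r'.
  by rewrite belowE => rr'; exact: ext_sub rr' _ _.
have hit_real r : dom (Q a) r -> freal (Q a) hit r.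
  move=> dr; apply: (frealI preQ dr) => [r1 n i i' r1r|r1 n r1r].
    have dr1 := ext_doml r1r.
    move=> /(hitE _ _ _ dr1)/(_ r1 (ext_refl preQ dr1))[r2 r21 [c [Ac r2c ->]]].
    move=> /(hitE _ _ _ dr1)/(_ r2 r21)[r3 r32 [c' [Ac' r3c' ->]]].
    congr (idx (n, _)); apply: (proj2 (antiA n)) => //; exists r3.
    by split; apply: QaP => //; exact: ext_trans r32 r2c.
  have dr1 := ext_doml r1r.
  have [c Ac [r2 [r21 r2c]]] := maxA n (ext_doml (QaP _ _ (ext_refl preQ dr1))).
  exists (idx (n, c)), (Defs.restrict r2 a).
  have r2c' := ext_below r2c (Aa Ac).
  split.
    by apply: ext_below r21 _; rewrite belowE in dr1; exact: supp_iter dr1.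
  apply/(hitE _ _ _ (ext_doml r2c')) => r3 r32.
  exists r3; first exact: (ext_refl preQ (ext_doml r32)).
  by exists c; split=> //; exact: ext_trans r32 r2c'.
have [q' [N [q'q dom_hit]]] :=
  decides_dominates setT_down_closed I hit_real (ext_doml qp).
exists N, q'; split=> // n r Nn rq'.
apply: (regular_fex preP _).2 => [|r1 r1r]; first exact: ext_doml rq'.
have [r2 [c [m [r21 Ac r2c r2m]]]] := settled_dense n (ext_doml r1r).
have r2q' := ext_trans preP (ext_trans preP r21 r1r) rq'.
have r2p := ext_trans preP (ext_trans preP r2q' q'q) qp.
have dr2 := ext_doml r21.
have [V' [r3 [r32 oV' V'1 V'r3]]] := fnbhs_dense preP (Up n) r2p.
have r3c := ext_trans preP r32 r2c.
have [_ _ /(_ _ _ r3c oV' V'1 V'r3) Vc] := AV Ac.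
exists r3; first exact: ext_trans r32 r21.
have [z [Vz ->]] := idxP (n, c) Ac.
apply: (fprodI preP (ext_doml r32)) => /=; last first.
  exact: (ext_forces_subset preP r3c Vc).
have r3m := ext_decides r32 r2m.
apply/(guess_settled _ Ac r3c r3m (ext_refl preP (ext_doml r32))).
exists (idx (n, c)) => //; rewrite ltnS.
apply: (dom_hit r3) r3m _ => //; first exact: ext_trans r32 r2q'.
have r3ac := ext_below r3c (Aa Ac).
apply/(hitE _ _ _ (ext_doml r3ac)) => r4 r43.
exists r4; first exact: (ext_refl preQ (ext_doml r43)).
by exists c; split=> //; exact: ext_trans r43 r3ac.
Qed.

End Construction.

Theorem theorem19 (d : Order.disp_t) (K : orderType d)
    (hK : is_cardinal K) (hcof : uncountable_cofinality K)
    (G : topologicalGroupType) (hT0 : kolmogorov_space G)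
    (hG : aleph0_bounded G) :
  forces (iteration_one K)
    (fS1_Omega_nbd_Gamma (hechler_iteration (proj1 hK)) G).
Proof.
pose P := iteration (proj1 hK) setT.
have preP : preorder_on P := preorder_iter _ _.
have cccP : ccc P by exact: ccc_iter.
move=> U nU; rewrite -/P.
have [A [V [e [antiA maxA AV AVe]]]] := nbhd_antichains (proj1 hK) hG U.
have [|a aP] := uncountable_cofinality_bound
    (X := \bigcup_n \bigcup_(c in A n) supp c) hcof.
  apply: bigcup_countable => [|n _]; first exact: countableP.
  apply: bigcup_countable => [|c Ac]; first exact/cccP/antiA.
  apply: finite_set_countable; have [AP _] := antiA n.
  by case: ((dom_iter (proj1 hK) setT c).1 (AP c Ac)).
have Aa n c : A n c -> supp c `<=` seg a.
  by move=> Ac b cb; apply: aP; exists n => //; exists c.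
pose F := guess (proj1 hK) A e a.
have regF (F' : name (cond K) (nat * G)) : regular P (fand
    (fall (fun n => ffinite P (term F' n)))
    (fall (fun x : G => fex P (fun N : nat => fall (fun n =>
       fimp P (fcheck (N <= n)) (Defs.fprod P x (term F' n) (term U n))))))).
  by apply: regular_fand; apply: regular_fall => ?; exact: regular_fex.
apply/(fimpE preP); first by apply: regular_fall => n; exact: regular_fexS.
- exact: regular_fexS.
- exact: (proj1 (iteration_one_greatest (proj1 hK))).
move=> p p1 Up; have dp := ext_doml p1.
apply: (fexSI preP (t := F)) => //; first exact: guess_name.
  exact: (regF F).1.
split=> [n|x]; first exact: (guess_finite antiA maxA).
apply: (regular_fex preP _).2 => // q qp.
have [N [r [rq cov]]] := guess_covers antiA maxA AV AVe Aa x Up qp.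
exists r => //; have dr := ext_doml rq.
have reg N' n : regular P (fimp P (@fcheck (cond K) (N' <= n))
    (Defs.fprod P x (term F n) (term U n))).
  by apply: regular_fimp => //; exact: regular_fcheck.
apply: (fexI preP (a := N)) => //.
  by apply: (proj1 (regular_fall _)) => n; exact: reg.
move=> n; apply/(fimpE preP) => //.
- exact: regular_fcheck.
- exact: regular_fex.
- by move=> r' r'r Nn; exact: cov r'r.
Qed.
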